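(* Let $n\ge1$, let $A=(a_{i,j})_{1\le i,j\le n}$ be an $n\times n$ matrix (entries generic, e.g. indeterminates) and $\lambda_a,\mu_a$ parameters. Then $$|A|_{\lambda,\mu}=\sum_{B}\ \prod_{a=2-n}^{n-2}\lambda_a^{\mathrm I_a(B)}\,\mu_a^{\mathrm I'_a(B)}\ \prod_{i,j=1}^n a_{i,j}^{b_{i,j}}\,\big(\lambda_{j-i}+\mu_{i+j-n-1}\big)^{\delta_{b_{i,j},-1}},$$ where the sum is over all $n\times n$ alternating sign matrices $B=(b_{i,j})$; $\mathrm I_a(B)$ is the number of entries $b_{i,j}=0$ with $j-i=a$ such that the first nonzero entry of $B$ to its right in row $i$ and the first nonzero entry below it in column $j$ both exist and equal $1$; and $\mathrm I'_a(B)$ is the number of entries $b_{i,j}=0$ with $i+j-n-1=a$ such that the first nonzero entry to its right in row $i$ and the first nonzero entry above it in column $j$ both exist and equal $1$.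
   Context: An alternating sign matrix is a square matrix with entries in $\{0,1,-1\}$ such that in every row and column the nonzero entries alternate in sign, starting and ending with $1$. Generalized Lambda-determinant: define $T_{i,j,k}$ for $i,j\in\mathbb Z$, $k\ge 0$, $i+j+k\equiv n \pmod 2$, by $T_{i,j,0}=1$ ($i+j\equiv n$ mod 2), $T_{i,j,1}=a_{\frac{j-i+n+1}{2},\frac{i+j+n+1}{2}}$ ($i+j\equiv n+1$ mod 2, $|i|+|j|\le n-1$), and $T_{i,j,k+1}T_{i,j,k-1}=\mu_j\,T_{i,j+1,k}T_{i,j-1,k}+\lambda_i\,T_{i+1,j,k}T_{i-1,j,k}$; then $|A|_{\lambda,\mu}:=T_{0,0,n}$. Here $x^0=1$. *)

(* Defs.v *)
From HB Require Import structures.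
From mathcomp Require Import all_boot all_order all_algebra.
From mathcomp Require Import ring lra zify.
From mathcomp.multinomials Require Import mpoly.

Set Implicit Arguments.
Unset Strict Implicit.
Unset Printing Implicit Defensive.

Import Order.TTheory GRing.Theory Num.Theory.
Local Open Scope ring_scope.

(* The entry a_{r,c} with r, c counted from 1; the value 1 returned outside
   the range is never reached when computing T_{0,0,n}. *)
Definition entry1 (F : fieldType) (n : nat) (A : 'M[F]_n) (r c : int) : F :=
  match r, c with
  | Posz r'.+1, Posz c'.+1 =>
      match @insub nat (fun k => (k < n)%N) 'I_n r',
            @insub nat (fun k => (k < n)%N) 'I_n c' with
      | Some p, Some q => A p q
      | _, _ => 1
      end
  | _, _ => 1
  end.

(* [Tsys A lam mu k i j] is T_{i,j,k}.  Only the values with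
   i + j + k = n mod 2 and |i| + |j| + k <= n are meaningful. *)
Fixpoint Tsys (F : fieldType) (n : nat) (A : 'M[F]_n) (lam mu : int -> F)
    (k : nat) (i j : int) {struct k} : F :=
  match k with
  | 0 => 1
  | k1.+1 =>
    match k1 with
    | 0 => entry1 A ((j - i + n%:Z + 1) %/ 2)%Z ((i + j + n%:Z + 1) %/ 2)%Z
    | k2.+1 =>
      (mu j * Tsys A lam mu k1 i (j + 1) * Tsys A lam mu k1 i (j - 1)
       + lam i * Tsys A lam mu k1 (i + 1) j * Tsys A lam mu k1 (i - 1) j)
      / Tsys A lam mu k2 i j
    end
  end.

Definition lambda_det (F : fieldType) (n : nat) (A : 'M[F]_n)
    (lam mu : int -> F) : F := Tsys A lam mu n 0 0.

(* Genericity: the T_{i,j,k} by which the recursion divides on its way to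
   T_{0,0,n} do not vanish. *)
Definition generic (F : fieldType) (n : nat) (A : 'M[F]_n)
    (lam mu : int -> F) : Prop :=
  forall (i j : int) (k : nat),
    (i + j + k%:Z = n%:Z %[mod 2])%Z ->
    `|i| + `|j| + k%:Z + 2 <= n%:Z ->
    Tsys A lam mu k i j != 0.

Lemma Tsys_octahedron (F : fieldType) (n : nat) (A : 'M[F]_n)
    (lam mu : int -> F) (i j : int) (k : nat) :
  generic A lam mu ->
  (0 < k)%N ->
  (i + j + k%:Z + 1 = n%:Z %[mod 2])%Z ->
  `|i| + `|j| + k%:Z + 1 <= n%:Z ->
  Tsys A lam mu k.+1 i j * Tsys A lam mu k.-1 i j =
    mu j * Tsys A lam mu k i (j + 1) * Tsys A lam mu k i (j - 1)
    + lam i * Tsys A lam mu k (i + 1) j * Tsys A lam mu k (i - 1) j.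
Proof.
case: k => [//|k] gA _ par le_n.
rewrite [Tsys _ _ _ k.+2 _ _]/= divfK //; apply: gA; last by lia.
by move: par; lia.
Qed.

Lemma Tsys1_entry (F : fieldType) (n : nat) (A : 'M[F]_n)
    (lam mu : int -> F) (p q : 'I_n) :
  Tsys A lam mu 1 (q%:Z - p%:Z) (p.+1%:Z + q.+1%:Z - n%:Z - 1) = A p q.
Proof.
rewrite /=.
have -> : ((p.+1%:Z + q.+1%:Z - n%:Z - 1 - (q%:Z - p%:Z) + n%:Z + 1) %/ 2)%Z
   = p.+1 by lia.
have -> : ((q%:Z - p%:Z + (p.+1%:Z + q.+1%:Z - n%:Z - 1) + n%:Z + 1) %/ 2)%Z
   = q.+1 by lia.
by rewrite /entry1 !insubT ?ltn_ord //= => lp lq; congr (A _ _); apply: val_inj.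
Qed.

(* [generic] holds when the entries and the parameters are images, in the
   fraction field of a domain, of elements made positive by some ring morphism;
   in particular when they are indeterminates. *)
Lemma generic_pos (R : idomainType) (ev : {rmorphism R -> rat}) (n : nat)
    (A : 'M[R]_n) (lam mu : int -> R) :
  (forall i j, 0 < ev (A i j)) ->
  (forall a, 0 < ev (lam a)) -> (forall a, 0 < ev (mu a)) ->
  generic (map_mx (@tofrac R) A) (fun a => tofrac (lam a))
    (fun a => tofrac (mu a)).
Proof.
move=> A_gt0 lam_gt0 mu_gt0.
pose pos (x : {fraction R}) := exists p q : R,
  [/\ 0 < ev p, 0 < ev q & x = tofrac p / tofrac q].
have nz (p : R) : 0 < ev p -> tofrac p != 0.
  by rewrite tofrac_eq0; apply: contraTneq => ->; rewrite rmorph0 ltxx.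
have pos_nz x : pos x -> x != 0.
  by case=> p [q [p0 q0 ->]]; rewrite mulf_neq0 ?invr_eq0 ?nz.
have pos_in p : 0 < ev p -> pos (tofrac p).
  by move=> p0; exists p, 1; rewrite rmorph1 rmorph1 divr1.
have posD x y : pos x -> pos y -> pos (x + y).
  move=> [p [q [p0 q0 ->]]] [r [s [r0 s0 ->]]].
  exists (p * s + r * q), (q * s); split.
  - by rewrite rmorphD !rmorphM addr_gt0 ?mulr_gt0.
  - by rewrite rmorphM mulr_gt0.
  - by rewrite addf_div ?nz // rmorphD !rmorphM.
have posM x y : pos x -> pos y -> pos (x * y).
  move=> [p [q [p0 q0 ->]]] [r [s [r0 s0 ->]]].
  exists (p * r), (q * s); split; try by rewrite rmorphM mulr_gt0.
  by rewrite mulf_div !rmorphM.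
have posV x : pos x -> pos x^-1.
  by move=> [p [q [p0 q0 ->]]]; exists q, p; rewrite invf_div.
have pos1 : pos 1 by rewrite -(rmorph1 (@tofrac R)); apply: pos_in; rewrite rmorph1.
move=> i j k _ _; apply: pos_nz.
suff: (forall i j, pos (Tsys (map_mx (@tofrac R) A) (fun a => tofrac (lam a))
          (fun a => tofrac (mu a)) k i j)) /\
      (forall i j, pos (Tsys (map_mx (@tofrac R) A) (fun a => tofrac (lam a))
          (fun a => tofrac (mu a)) k.+1 i j)) by case.
elim: k {i j} => [|k [IH0 IH1]]; split=> // i j.
- rewrite /= /entry1; case: (_ %/ 2)%Z => [[|r]|r] //.
  case: (_ %/ 2)%Z => [[|c]|c] //.
  case: insubP => [p _ _|_] //; case: insubP => [q _ _|_] //.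
  by rewrite mxE; apply: pos_in.
- apply: (posM); last exact/posV/IH0.
  apply: posD; apply: (posM); try exact: IH1.
    by apply: (posM); [exact: pos_in | exact: IH1].
  by apply: (posM); [exact: pos_in | exact: IH1].
Qed.

Lemma generic_indeterminates (n N : nat) (x : 'I_n -> 'I_n -> 'I_N)
    (l m : int -> 'I_N) :
  generic (\matrix_(i, j) tofrac ('X_(x i j) : {mpoly rat[N]}))
    (fun a => tofrac ('X_(l a) : {mpoly rat[N]}))
    (fun a => tofrac ('X_(m a) : {mpoly rat[N]})).
Proof.
have X_gt0 u : 0 < meval (fun=> 1) ('X_u : {mpoly rat[N]}) by rewrite mevalXU.
have := @generic_pos {mpoly rat[N]} (meval (fun=> 1)) n
  (\matrix_(i, j) 'X_(x i j)) (fun a => 'X_(l a)) (fun a => 'X_(m a)).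
have -> : map_mx (@tofrac {mpoly rat[N]}) (\matrix_(i, j) 'X_(x i j))
   = \matrix_(i, j) tofrac ('X_(x i j) : {mpoly rat[N]}).
  by apply/matrixP => i j; rewrite !mxE.
by apply=> [i j|a|a]; rewrite ?mxE; apply: X_gt0.
Qed.

Definition alternating (s : seq int) : bool :=
  let t := [seq x <- s | x != 0] in
  [&& head 0 t == 1, last 0 t == 1 & sorted (fun x y => y == - x) t].

Definition is_asm (n : nat) (B : 'M[int]_n) : bool :=
  [&& [forall i, forall j, B i j \in [:: 0; 1; -1]],
      [forall i, alternating [seq B i j | j <- enum 'I_n]] &
      [forall j, alternating [seq B i j | i <- enum 'I_n]]].

(* The duplicate-free list of all n x n alternating sign matrices: a matrix
   over {0, 1, 2} codes its entries plus 1. *)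
Definition decode (n : nat) (C : 'M['I_3]_n) : 'M[int]_n :=
  \matrix_(i, j) ((C i j)%:Z - 1).

Definition asms (n : nat) : seq 'M[int]_n :=
  [seq B <- [seq decode C | C <- enum {: 'M['I_3]_n}] | is_asm B].

Lemma mem_asms (n : nat) (B : 'M[int]_n) : (B \in asms n) = is_asm B.
Proof.
rewrite mem_filter andb_idr // => /and3P[/forallP B01 _ _].
apply/mapP; exists (\matrix_(i, j) inord (absz (B i j + 1))).
  by rewrite mem_enum.
apply/matrixP => i j; rewrite !mxE.
by move: (B01 i) => /forallP/(_ j); rewrite !inE => /or3P[] /eqP ->;
  rewrite inordK.
Qed.

Lemma asms_uniq (n : nat) : uniq (asms n).
Proof.
rewrite filter_uniq // map_inj_uniq ?enum_uniq // => C D /matrixP CD.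
apply/matrixP => i j; apply: val_inj; move: (CD i j); rewrite !mxE.
by move/addIr => [].
Qed.

(* The integers a with 2 - n <= a <= n - 2. *)
Definition diags (n : nat) : seq int :=
  [seq k%:Z + 2 - n%:Z | k <- iota 0 (2 * n - 3)].

Lemma mem_diags (n : nat) (a : int) :
  (a \in diags n) = (2 - n%:Z <= a <= n%:Z - 2).
Proof.
apply/mapP/idP => [[k]|ha]; first by rewrite mem_iota => ? ->; lia.
by exists (absz (a - 2 + n%:Z)); rewrite ?mem_iota; lia.
Qed.

Lemma diags_uniq (n : nat) : uniq (diags n).
Proof. by rewrite map_inj_uniq ?iota_uniq // => k l; lia. Qed.

Definition right1 (n : nat) (B : 'M[int]_n) (i j : 'I_n) : bool :=
  [exists q : 'I_n, [&& (j < q)%N, B i q == 1 &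
    [forall r : 'I_n, (j < r < q)%N ==> (B i r == 0)]]].

Definition below1 (n : nat) (B : 'M[int]_n) (i j : 'I_n) : bool :=
  [exists p : 'I_n, [&& (i < p)%N, B p j == 1 &
    [forall r : 'I_n, (i < r < p)%N ==> (B r j == 0)]]].

Definition above1 (n : nat) (B : 'M[int]_n) (i j : 'I_n) : bool :=
  [exists p : 'I_n, [&& (p < i)%N, B p j == 1 &
    [forall r : 'I_n, (p < r < i)%N ==> (B r j == 0)]]].

(* 'I_n counts from 0: the 1-based indices of (i, j) are i.+1 and j.+1. *)
Definition cdiag (n : nat) (i j : 'I_n) : int := j.+1%:Z - i.+1%:Z.
Definition cadiag (n : nat) (i j : 'I_n) : int := i.+1%:Z + j.+1%:Z - n%:Z - 1.

Definition inv_diag (n : nat) (B : 'M[int]_n) (a : int) : nat :=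
  #|[set p : 'I_n * 'I_n | [&& B p.1 p.2 == 0, cdiag p.1 p.2 == a,
      right1 B p.1 p.2 & below1 B p.1 p.2]]|.

Definition inv_adiag (n : nat) (B : 'M[int]_n) (a : int) : nat :=
  #|[set p : 'I_n * 'I_n | [&& B p.1 p.2 == 0, cadiag p.1 p.2 == a,
      right1 B p.1 p.2 & above1 B p.1 p.2]]|.

(* Main.v *)
Require Import Defs.
From mathcomp Require Import all_boot all_order all_algebra.
From mathcomp Require Import ring zify.

Set Implicit Arguments.
Unset Strict Implicit.
Unset Printing Implicit Defensive.

Import Order.TTheory GRing.Theory Num.Theory.
Local Open Scope ring_scope.

(** Encode an alternating sign matrix [B] by its corner sums [b]. Following
   Robbins and Rumsey, [T_{0,0,n}] is expanded, for every [m], as a sum over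
   pairs of alternating sign matrices [B], [C] of sizes [m + 1] and [m] with
   interlacing corner sums, of [T_{k+1}^B T_k^{-C}] times a monomial in the
   parameters, where [k = n - m - 1]. For fixed [B] the admissible [C] differ by
   one independent binary choice at each entry [-1] of [B], and the admissible
   matrices of size [m + 2] by one at each entry [1]. Both sums thus factor, and
   the octahedron relation at the entries of [B] turns one into the other, which
   carries the expansion from [m] to [m + 1]. At [k = 0], where [T_0 = 1],
   summing over [C] gives the factors [lambda + mu].

   This divides by the parameters and by all the [T_{i,j,k}]. The general case
   follows by specialisation at [t = 0] from [F(t)], with the data deformed along
   a path to [A = 1], [lambda = 0], [mu = 1] at [t = 1], where every
   [T_{i,j,k}] is [1]. *)

(** * Products over a square of indices *)

Section DoubleProducts.
Variable F : fieldType.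
Implicit Types (f g : nat -> nat -> F).

Definition dprod (N : nat) f : F :=
  \prod_(0 <= p < N) \prod_(0 <= q < N) f p q.

Lemma eq_dprod N f g :
  (forall p q, (p < N)%N -> (q < N)%N -> f p q = g p q) ->
  dprod N f = dprod N g.
Proof.
by move=> fg; apply: eq_big_nat => p pN; apply: eq_big_nat => q qN; apply: fg;
  lia.
Qed.

Lemma dprodM N f g :
  dprod N (fun p q => f p q * g p q) = dprod N f * dprod N g.
Proof. by rewrite /dprod -big_split; apply: eq_bigr => p _; rewrite -big_split. Qed.

Lemma dprod1 N f :
  (forall p q, (p < N)%N -> (q < N)%N -> f p q = 1) -> dprod N f = 1.
Proof.
by move=> f1; rewrite /dprod big_nat big1 // => p pN;
  rewrite big_nat big1 // => q qN; apply: f1; lia.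
Qed.

(** In the suffixes of this and the next three lemmas the first letter tells whether the first or
    the last row is trivial, the second letter the same for the column. *)
Lemma dprod_ll N f :
  (forall p, (p <= N)%N -> f p N = 1) -> (forall q, (q <= N)%N -> f N q = 1) ->
  dprod N.+1 f = dprod N f.
Proof.
move=> fpN fNq; rewrite /dprod big_nat_recr //=.
have -> : \prod_(0 <= q < N.+1) f N q = 1.
  by rewrite big_nat big1 // => q qN; apply: fNq; lia.
rewrite mulr1; apply: eq_big_nat => p pN; rewrite big_nat_recr //= fpN ?mulr1 //; lia.
Qed.

Lemma dprod_ff N f :
  (forall p, (p <= N)%N -> f p 0%N = 1) -> (forall q, (q <= N)%N -> f 0%N q = 1) ->
  dprod N.+1 f = dprod N (fun p q => f p.+1 q.+1).
Proof.
move=> fp0 f0q; rewrite /dprod big_nat_recl //=.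
have -> : \prod_(0 <= q < N.+1) f 0%N q = 1.
  by rewrite big_nat big1 // => q qN; apply: f0q; lia.
rewrite mul1r; apply: eq_big_nat => p pN; rewrite big_nat_recl //= fp0 ?mul1r //; lia.
Qed.

Lemma dprod_fl N f :
  (forall p, (p <= N)%N -> f p N = 1) -> (forall q, (q <= N)%N -> f 0%N q = 1) ->
  dprod N.+1 f = dprod N (fun p q => f p.+1 q).
Proof.
move=> fpN f0q; rewrite /dprod big_nat_recl //=.
have -> : \prod_(0 <= q < N.+1) f 0%N q = 1.
  by rewrite big_nat big1 // => q qN; apply: f0q; lia.
rewrite mul1r; apply: eq_big_nat => p pN; rewrite big_nat_recr //= fpN ?mulr1 //; lia.
Qed.

Lemma dprod_lf N f :
  (forall p, (p <= N)%N -> f p 0%N = 1) -> (forall q, (q <= N)%N -> f N q = 1) ->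
  dprod N.+1 f = dprod N (fun p q => f p q.+1).
Proof.
move=> fp0 fNq; rewrite /dprod big_nat_recr //=.
have -> : \prod_(0 <= q < N.+1) f N q = 1.
  by rewrite big_nat big1 // => q qN; apply: fNq; lia.
rewrite mulr1; apply: eq_big_nat => p pN; rewrite big_nat_recl //= fp0 ?mul1r //; lia.
Qed.

End DoubleProducts.

(** * Mixed differences and multiplicative summation by parts *)

Definition d2 (h : nat -> nat -> int) (p q : nat) : int :=
  h p.+1 q.+1 - h p q.+1 - h p.+1 q + h p q.

Section SummationByParts.
Variable F : fieldType.

(** Abel summation in the exponents; the boundary terms drop out because [d] vanishes at both
    ends. *)
Lemma prod_by_parts N (g : nat -> F) (d : nat -> int) :
  (forall p, g p != 0) -> d 0%N = 0 -> d N.+1 = 0 ->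
  \prod_(0 <= p < N.+1) g p ^ (d p.+1 - d p) =
  \prod_(0 <= p < N) (g p / g p.+1) ^ d p.+1.
Proof.
move=> g0 d0 dN.
(* Keeping the upper boundary term makes the identity inductive in [M]. *)
have E M : \prod_(0 <= p < M.+1) g p ^ (d p.+1 - d p) =
  g M ^ d M.+1 * \prod_(0 <= p < M) (g p / g p.+1) ^ d p.+1.
  elim: M => [|M IH]; first by rewrite big_nat1 big_geq // d0 subr0 mulr1.
  rewrite big_nat_recr //= IH [in RHS]big_nat_recr //=.
  rewrite expfzDr // expfzMl exprz_inv; ring.
by rewrite E dN mul1r.
Qed.

Definition cross (Y : nat -> nat -> F) p q : F :=
  (Y p q * Y p.+1 q.+1) / (Y p q.+1 * Y p.+1 q).

Lemma dprod_by_parts N (Y : nat -> nat -> F) (d : nat -> nat -> int) :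
  (forall p q, Y p q != 0) ->
  (forall p, (p <= N.+1)%N -> d p 0%N = 0) ->
  (forall q, (q <= N.+1)%N -> d 0%N q = 0) ->
  (forall p, (p <= N.+1)%N -> d p N.+1 = 0) ->
  (forall q, (q <= N.+1)%N -> d N.+1 q = 0) ->
  dprod N.+1 (fun p q => Y p q ^ d2 d p q) =
  dprod N (fun p q => cross Y p q ^ d p.+1 q.+1).
Proof.
move=> Y0 dp0 d0q dpN dNq.
transitivity (\prod_(0 <= p < N.+1) \prod_(0 <= q < N)
   (Y p q / Y p q.+1) ^ (d p.+1 q.+1 - d p q.+1)).
  apply: eq_big_nat => p pN.
  rewrite -(@prod_by_parts N (Y p) (fun q => d p.+1 q - d p q)) //.
  - by apply: eq_bigr => q _; congr (_ ^ _); rewrite /d2; ring.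
  - by rewrite !dp0; lia.
  - by rewrite !dpN; lia.
rewrite exchange_big /= /dprod [RHS]exchange_big /=.
apply: eq_big_nat => q qN.
rewrite (@prod_by_parts N (fun p => Y p q / Y p q.+1) (fun p => d p q.+1)).
- apply: eq_bigr => p _; congr (_ ^ _); rewrite /cross; field.
  by rewrite !Y0.
- by move=> p; rewrite mulf_neq0 ?invr_eq0 ?Y0.
- by rewrite d0q; lia.
- by rewrite dNq; lia.
Qed.

End SummationByParts.

(** * Corner-sum functions and interlacing *)

(** These are the corner sums of an alternating sign matrix of size [m] padded by zeros: a step in
    [i] or [j] is a partial sum of a row or column, hence 0 or 1, and [d2 h p q] is the matrix
    entry. *)
Record height (m : nat) (h : nat -> nat -> int) : Prop := Height {
  height_i0 : forall i, h i 0%N = 0;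
  height_0j : forall j, h 0%N j = 0;
  height_im : forall i, (i <= m)%N -> h i m = i;
  height_mj : forall j, (j <= m)%N -> h m j = j;
  height_stepi : forall i j, h i j <= h i.+1 j <= h i j + 1;
  height_stepj : forall i j, h i j <= h i j.+1 <= h i j + 1;
  height_clampi : forall i j, (m <= i)%N -> h i j = h m j;
  height_clampj : forall i j, (m <= j)%N -> h i j = h i m }.

(** For a corner-sum array [b] the admissible interval contains two integers where [d2 b p q] is -1
    and one elsewhere. *)
Definition interlace (b : nat -> nat -> int) (p q : nat) (x : int) : bool :=
  [&& b p q <= x, b p.+1 q.+1 - 1 <= x, x <= b p.+1 q & x <= b p q.+1].

Definition compat (m : nat) (b c : nat -> nat -> int) : Prop :=
  forall p q, (p <= m)%N -> (q <= m)%N -> interlace b p q (c p q).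

Definition boundary m (b : nat -> nat -> int) : Prop :=
  [/\ forall p, (p <= m)%N -> b p 0%N = 0, forall q, (q <= m)%N -> b 0%N q = 0,
      forall p, (p <= m)%N -> b p m = p & forall q, (q <= m)%N -> b m q = q].

(** The upper end of the interval of [interlace], used as the base point of the binary choices. *)
Definition lower_max (b : nat -> nat -> int) (p q : nat) : int :=
  Num.min (b p.+1 q) (b p q.+1).

(* The maximum is the right value everywhere except at the corner (m, m),
   where the clamped [b] gives m - 1. *)
Definition upper_min (m : nat) (b : nat -> nat -> int) (i j : nat) : int :=
  if (m <= i)%N && (m <= j)%N then m%:Z else
  Num.max (b i j.-1) (b i.-1 j).

(** * Weights of interlacing pairs and the octahedron exchange *)

Section Weights.
Variables (F : fieldType) (lam mu : int -> F).
Hypotheses (lam0 : forall a, lam a != 0) (mu0 : forall a, mu a != 0).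

(** Position [(p, q)] of an array of size [m] carries the indices [i = q - p] and
    [j = p + q + 1 - m] of [T]. *)
Definition lamc (p q : nat) : F := lam (q%:Z - p%:Z).
Definition muc (m p q : nat) : F := mu ((p + q + 1)%:Z - m%:Z).

Lemma lamc_neq0 p q : lamc p q != 0. Proof. exact: lam0. Qed.
Lemma muc_neq0 m p q : muc m p q != 0. Proof. exact: mu0. Qed.

Lemma mucS m p q : muc m.+1 p.+1 q = muc m p q.
Proof. by congr mu; lia. Qed.

(** For a corner-sum array [b] and a compatible [c], every exponent here is 0 or 1. *)
Definition pweight m (b c : nat -> nat -> int) : F :=
  dprod m (fun p q => muc m p q ^ (b p.+1 q.+1 - c p.+1 q) *
                      lamc p q ^ (c p q + 1 - b p.+1 q.+1)).

(* In terms of 0-based indices, the central entries of the next larger array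
   [Y] are those shifted by (1, 1). *)
Definition weight m (X Y : nat -> nat -> F) (b c : nat -> nat -> int) : F :=
  dprod m.+1 (fun p q => X p q ^ d2 b p q) *
  (dprod m (fun p q => Y p.+1 q.+1 ^ (- d2 c p q)) * pweight m b c).

(** The ratio of the two terms on the right of the octahedron relation: [1 + wratio] is that
    right-hand side divided by its [lamc] term. *)
Definition wratio m (Y : nat -> nat -> F) (p q : nat) : F :=
  muc m p q / lamc p q * cross Y p q.

Lemma compat_boundary m b c : height m.+1 b -> compat m b c ->
  boundary m c.
Proof.
move=> hb bc; split=> [p pm|q qm|p pm|q qm].
- have := bc p 0%N pm isT; rewrite /interlace !(height_i0 hb).
  have := height_stepj hb p.+1 0; rewrite (height_i0 hb); lia.
- have := bc 0%N q isT qm; rewrite /interlace !(height_0j hb).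
  have := height_stepi hb 0 q.+1; rewrite (height_0j hb); lia.
- have := bc p m pm (leqnn m); rewrite /interlace !(height_im hb) //; lia.
- have := bc m q (leqnn m) qm; rewrite /interlace !(height_mj hb) //; lia.
Qed.

Lemma height_le_i m b i j : height m b -> 0 <= b i j <= i.
Proof.
move=> hb; elim: i => [|i IH]; first by rewrite (height_0j hb).
have := height_stepi hb i j; lia.
Qed.

Lemma height_cell m b p q : height m b ->
  [/\ b p q <= b p.+1 q <= b p q + 1, b p q <= b p q.+1 <= b p q + 1,
      b p.+1 q <= b p.+1 q.+1 <= b p.+1 q + 1 &
      b p q.+1 <= b p.+1 q.+1 <= b p q.+1 + 1].
Proof.
move=> hb; split.
- exact: height_stepi hb p q.
- exact: height_stepj hb p q.
- exact: height_stepj hb p.+1 q.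
- exact: height_stepi hb p q.+1.
Qed.

Lemma compat_lower_max m b : height m.+1 b -> compat m b (lower_max b).
Proof.
move=> hb p q pm qm; have [] := height_cell p q hb.
by rewrite /interlace /lower_max; lia.
Qed.

(** The difference [d] of [lower_max b] and [c] vanishes on the boundary. Summation by parts
    therefore turns the powers [d2 d] of [Y] into powers [d] of [cross Y], and a shift of the row
    index lines up the exponents of [muc] with those of [lamc]. *)
Lemma weight_lower m X Y b c : (forall p q, Y p q != 0) ->
  height m.+1 b -> compat m b c ->
  weight m X Y b c = weight m X Y b (lower_max b) *
    dprod m.+1 (fun p q => wratio m.+1 Y p q ^ (lower_max b p q - c p q)).
Proof.
move=> Y0 hb bc.
have [c1 c2 c3 c4] := compat_boundary hb bc.
have [e1 e2 e3 e4] := compat_boundary hb (compat_lower_max hb).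
pose d p q := lower_max b p q - c p q.
have d1 p : (p <= m)%N -> d p 0%N = 0 by move=> pm; rewrite /d c1 ?e1.
have d2' p : (p <= m)%N -> d 0%N p = 0 by move=> pm; rewrite /d c2 ?e2.
have d3 p : (p <= m)%N -> d p m = 0 by move=> pm; rewrite /d c3 ?e3 ?subrr.
have d4 p : (p <= m)%N -> d m p = 0 by move=> pm; rewrite /d c4 ?e4 ?subrr.
rewrite (@eq_dprod _ m.+1 (fun p q => wratio m.+1 Y p q ^ (lower_max b p q - c p q))
  (fun p q => (muc m.+1 p q ^ d p q * lamc p q ^ (- d p q)) *
     cross Y p q ^ d p q)); last first.
  by move=> p q _ _; rewrite /wratio !expfzMl exprz_inv.
rewrite !dprodM.
have -> : dprod m.+1 (fun p q => muc m.+1 p q ^ d p q) =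
          dprod m (fun p q => muc m p q ^ d p.+1 q).
  rewrite dprod_fl; first by apply: eq_dprod => p q _ _; rewrite mucS.
    by move=> p pm; rewrite d3.
  by move=> p pm; rewrite d2'.
have -> : dprod m.+1 (fun p q => lamc p q ^ (- d p q)) =
          dprod m (fun p q => lamc p q ^ (- d p q)).
  by rewrite dprod_ll // => p pm; rewrite ?d3 ?d4.
have -> : dprod m.+1 (fun p q => cross Y p q ^ d p q) =
          dprod m (fun p q => Y p.+1 q.+1 ^ d2 d p q).
  (* For [m = 0] there is a single factor, with exponent [d 0 0 = 0]. *)
  case: m d1 d2' d3 d4 {hb bc c1 c2 c3 c4 e1 e2 e3 e4} => [|m] d1 d2' d3 d4.
    rewrite [RHS]dprod1 // dprod1 // => p q.
    by rewrite !ltnS !leqn0 => /eqP -> /eqP ->; rewrite d1.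
  rewrite (@dprod_by_parts _ m (fun p q => Y p.+1 q.+1) d) //.
  by rewrite dprod_ll ?dprod_ff // => p pm; rewrite ?d1 ?d2' ?d3 ?d4 //; lia.
rewrite /weight /pweight -!mulrA; congr (_ * _).
rewrite -!dprodM; apply: eq_dprod => p q _ _.
have -> : b p.+1 q.+1 - c p.+1 q = b p.+1 q.+1 - lower_max b p.+1 q + d p.+1 q
  by rewrite /d; ring.
have -> : c p q + 1 - b p.+1 q.+1 = lower_max b p q + 1 - b p.+1 q.+1 - d p q
  by rewrite /d; ring.
have -> : - d2 c p q = - d2 (lower_max b) p q + d2 d p q
  by rewrite /d /d2; ring.
by rewrite !expfzDr ?lamc_neq0 ?muc_neq0 //; ring.
Qed.

Lemma upper_min_boundary m b :
  height m.+1 b -> boundary m.+2 (upper_min m.+2 b).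
Proof.
move=> hb; rewrite /upper_min; split=> [p pm|q qm|p pm|q qm].
- by rewrite ltn0 andbF !(height_i0 hb).
- by rewrite ltn0 !(height_0j hb).
- case: (leqP m.+2 p) => pm2 /=; first by rewrite leqnn; lia.
  rewrite (height_im hb); last by lia.
  rewrite (height_clampj hb) 1?(height_im hb); lia.
- case: (leqP m.+2 q) => qm2 /=; rewrite leqnn /=; first by lia.
  rewrite (height_mj hb); last by lia.
  rewrite (height_clampi hb) 1?(height_mj hb); lia.
Qed.

(** The counterpart of [weight_lower] with the larger array varying around [upper_min]; again the
    difference vanishes on the boundary and is summed by parts. *)
Lemma weight_upper m Y Z b b' : (forall p q, Y p q != 0) ->
  height m.+1 b -> boundary m.+2 b' ->
  weight m.+1 Y Z b' b = weight m.+1 Y Z (upper_min m.+2 b) b *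
    dprod m.+1 (fun p q =>
      wratio m.+1 Y p q ^ (b' p.+1 q.+1 - upper_min m.+2 b p.+1 q.+1)).
Proof.
move=> Y0 hb [c1 c2 c3 c4].
have [e1 e2 e3 e4] := upper_min_boundary hb.
set b0 := upper_min m.+2 b in e1 e2 e3 e4 *.
pose d p q := b' p q - b0 p q.
rewrite (@eq_dprod _ m.+1 (fun p q => wratio m.+1 Y p q ^ (b' p.+1 q.+1 - b0 p.+1 q.+1))
  (fun p q => (muc m.+1 p q ^ d p.+1 q.+1 * lamc p q ^ (- d p.+1 q.+1)) *
     cross Y p q ^ d p.+1 q.+1)); last first.
  by move=> p q _ _; rewrite /wratio !expfzMl exprz_inv.
rewrite !dprodM -(@dprod_by_parts _ m.+1 Y d) //; first last.
- by move=> q qm; rewrite /d c4 ?e4 ?subrr.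
- by move=> q qm; rewrite /d c3 ?e3 ?subrr.
- by move=> q qm; rewrite /d c2 ?e2 ?subrr.
- by move=> q qm; rewrite /d c1 ?e1 ?subrr.
rewrite /weight.
have -> : dprod m.+2 (fun p q => Y p q ^ d2 b' p q) =
  dprod m.+2 (fun p q => Y p q ^ d2 b0 p q) * dprod m.+2 (fun p q => Y p q ^ d2 d p q).
  rewrite -dprodM; apply: eq_dprod => p q _ _; rewrite -expfzDr //.
  by congr (_ ^ _); rewrite /d /d2; ring.
have -> : pweight m.+1 b' b = pweight m.+1 b0 b *
   (dprod m.+1 (fun p q => muc m.+1 p q ^ d p.+1 q.+1) *
    dprod m.+1 (fun p q => lamc p q ^ (- d p.+1 q.+1))).
  rewrite /pweight -!dprodM; apply: eq_dprod => p q _ _.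
  have -> : b' p.+1 q.+1 - b p.+1 q = b0 p.+1 q.+1 - b p.+1 q + d p.+1 q.+1
    by rewrite /d; ring.
  have -> : b p q + 1 - b' p.+1 q.+1 = b p q + 1 - b0 p.+1 q.+1 - d p.+1 q.+1
    by rewrite /d; ring.
  by rewrite !expfzDr ?lamc_neq0 ?muc_neq0 //; ring.
ring.
Qed.

Lemma d2_out m b p q : height m b -> (m <= p)%N || (m <= q)%N -> d2 b p q = 0.
Proof.
move=> hb /orP[mp|mq]; rewrite /d2.
  by rewrite (height_clampi hb q.+1 (leqW mp)) (height_clampi hb q (leqW mp))
     !(height_clampi hb _ mp); ring.
by rewrite (height_clampj hb p.+1 (leqW mq)) (height_clampj hb p (leqW mq))
     !(height_clampj hb _ mq); ring.
Qed.

(** This is [min x y + max x y = x + y]; the excluded corner is where [upper_min] is not the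
    maximum. *)
Lemma min_add_max m b p q : (p <= m)%N || (q <= m)%N ->
  upper_min m.+2 b p.+1 q.+1 = b p q.+1 + b p.+1 q - lower_max b p q.
Proof.
move=> pqm; rewrite /lower_max /upper_min /=; case: ifP => [/andP[pm qm]|_]; lia.
Qed.

(** Second differences of [min_add_max], whose terms are shifted against each other by one index.
    The guards cut [lower_max b] down to size [m]; the last row and column follow from the boundary
    values. *)
Lemma d2_upper_min m b p q : height m.+1 b -> (p <= m.+1)%N -> (q <= m.+1)%N ->
  d2 (upper_min m.+2 b) p q =
    (if q is q'.+1 then d2 b p q' else 0) +
    (if p is p'.+1 then d2 b p' q else 0) -
    (if p is p'.+1 then if q is q'.+1 then
       if (p' < m)%N && (q' < m)%N then d2 (lower_max b) p' q' else 0 else 0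
     else 0).
Proof.
move=> hb pm qm.
have [c1 c2 c3 c4] := compat_boundary hb (compat_lower_max hb).
have [e1 e2 e3 e4] := upper_min_boundary hb.
have [b1 b2 b3 b4] : [/\ forall i, b i 0%N = 0, forall j, b 0%N j = 0,
   forall i, (i <= m.+1)%N -> b i m.+1 = i & forall j, (j <= m.+1)%N -> b m.+1 j = j].
  by split; case: hb.
have uE p' q' : (p' <= m)%N || (q' <= m)%N -> upper_min m.+2 b p'.+1 q'.+1 =
  b p' q'.+1 + b p'.+1 q' - lower_max b p' q' by exact: min_add_max.
case: p pm => [|p] pm; case: q qm => [|q] qm; rewrite {1}/d2 ?e1 ?e2 //; try by lia.
- by rewrite uE // b1 b2 c1.
- rewrite (uE 0%N q) // b2 (c2 q); last lia.
  case: (ltnP q m) => qm'; first by rewrite uE // /d2 !b2 c2 //; lia.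
  have -> : q = m by lia.
  by rewrite e3 // /d2 !b2 b3 //; lia.
- rewrite (uE p 0%N) ?orbT // b1 (c1 p); last lia.
  case: (ltnP p m) => pm'; first by rewrite uE ?orbT // /d2 !b1 c1 //; lia.
  have -> : p = m by lia.
  by rewrite e4 // /d2 !b1 b4 //; lia.
rewrite (uE p q); last by lia.
case: (ltnP p m) => pm'; case: (ltnP q m) => qm' /=.
- by rewrite !uE ?pm' ?qm' ?orbT // /d2; ring.
- have qE : q = m by lia.
  subst q; rewrite !e3 1?(uE p.+1 m) ?orbT ?c3 //; try by lia.
  by rewrite (d2_out hb (q := m.+1)) ?ltnSn ?orbT // /d2 !b3; lia.
- have pE : p = m by lia.
  subst p; rewrite !e4 1?(uE m q.+1) ?orbT ?leqnn ?c4 //; try by lia.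
  by rewrite (d2_out hb (p := m.+1)) ?ltnSn ?orbT // /d2 !b4; lia.
- have pE : p = m by lia.
  have qE : q = m by lia.
  subst p q; rewrite !e4 ?e3 ?c4 //.
  by rewrite !(d2_out hb) ?ltnSn ?orbT // ?b3 ?b4 //; lia.
Qed.

(** Reindexing the three summands of the exponent in [d2_upper_min] separately collects the products
    [Y p q.+1 * Y p.+1 q] of the octahedron relation. *)
Lemma prod_upper_min m b (Y : nat -> nat -> F) : (forall p q, Y p q != 0) ->
  height m.+1 b ->
  dprod m.+2 (fun p q => Y p q ^ d2 (upper_min m.+2 b) p q) =
  dprod m.+1 (fun p q => (Y p q.+1 * Y p.+1 q) ^ d2 b p q) *
  dprod m (fun p q => Y p.+1 q.+1 ^ (- d2 (lower_max b) p q)).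
Proof.
move=> Y0 hb.
pose E1 p q : int := if q is q'.+1 then d2 b p q' else 0.
pose E2 p q : int := if p is p'.+1 then d2 b p' q else 0.
pose E3 p q : int := if p is p'.+1 then if q is q'.+1 then
       if (p' < m)%N && (q' < m)%N then d2 (lower_max b) p' q' else 0 else 0
     else 0.
rewrite (@eq_dprod _ _ _ (fun p q => Y p q ^ E1 p q * Y p q ^ E2 p q * Y p q ^ (- E3 p q))).
  rewrite !dprodM; congr (_ * _).
    rewrite dprod_lf; last 2 first.
    - by move=> p _; rewrite /E1.
    - by case=> // q _; rewrite /E1 (d2_out hb) ?leqnn.
    rewrite (dprod_fl (N := m.+1)); last 2 first.
    - by case=> // p _; rewrite /E2 (d2_out hb) ?leqnn ?orbT.
    - by move=> q _; rewrite /E2.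
    by rewrite -dprodM; apply: eq_dprod => p q _ _; rewrite expfzMl.
  rewrite dprod_ff //; last by case.
  rewrite dprod_ll.
  - by apply: eq_dprod => p q pm qm; rewrite /E3 pm qm.
  - by move=> p _; rewrite /E3 ltnn andbF.
  - by move=> p _; rewrite /E3 ltnn.
by move=> p q pm qm; rewrite -!expfzDr // (d2_upper_min hb).
Qed.

(** The range grows by a trivial row and column, so that the factors are indexed by the cells of
    [b]. *)
Lemma pweight_lower_max m b : height m.+1 b ->
  pweight m b (lower_max b) =
  dprod m.+1 (fun p q => muc m.+1 p q ^ (b p q.+1 - lower_max b p q) *
                      lamc p q ^ (lower_max b p q + 1 - b p.+1 q.+1)).
Proof.
move=> hb; have [c1 c2 c3 c4] := compat_boundary hb (compat_lower_max hb).
rewrite /pweight !dprodM; congr (_ * _).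
  rewrite [RHS]dprod_fl; first by apply: eq_dprod => p q _ _; rewrite mucS.
    by move=> p pm; rewrite c3 // (height_im hb) ?subrr // leqW.
  by move=> q qm; rewrite c2 // (height_0j hb).
rewrite [RHS]dprod_ll // => p pm.
  rewrite c3 // (height_im hb) //; suff -> : p%:Z + 1 - p.+1%:Z = 0 by []; lia.
rewrite c4 // (height_mj hb) //; suff -> : p%:Z + 1 - p.+1%:Z = 0 by []; lia.
Qed.

(** The comparison is made cell by cell: the octahedron relation expresses [X p q] through [Y], [Z]
    and [1 + wratio], and this is raised to the power [d2 b p q]. *)
Lemma weight_exchange m X Y Z b :
  (forall p q, X p q != 0) -> (forall p q, Y p q != 0) ->
  (forall p q, Z p q != 0) ->
  (forall p q, X p q * Z p.+1 q.+1 =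
     muc m.+1 p q * Y p q * Y p.+1 q.+1 + lamc p q * Y p q.+1 * Y p.+1 q) ->
  height m.+1 b ->
  weight m X Y b (lower_max b) *
    dprod m.+1 (fun p q => (1 + wratio m.+1 Y p q) ^+ (d2 b p q == -1)) =
  weight m.+1 Y Z (upper_min m.+2 b) b *
    dprod m.+1 (fun p q => (1 + wratio m.+1 Y p q) ^+ (d2 b p q == 1)).
Proof.
move=> X0 Y0 Z0 rec hb.
rewrite /weight (prod_upper_min Y0 hb) (pweight_lower_max hb) /pweight.
(* [D] collects the powers of [Y] with exponents [- d2 (lower_max b)]; it occurs on both sides and
   cancels. *)
set D := dprod m _.
rewrite [_ * (D * _)]mulrCA -!mulrA [in RHS]mulrCA; congr (_ * _).
rewrite -!dprodM; apply: eq_dprod => p q pm qm.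
(* A zero here would annihilate the right side of the octahedron relation, hence [X] or [Z]. *)
have S0 : 1 + wratio m.+1 Y p q != 0.
  have := mulf_neq0 (X0 p q) (Z0 p.+1 q.+1); rewrite rec.
  apply: contraNneq => S0.
  rewrite -(mulr0 (lamc p q * Y p q.+1 * Y p.+1 q)) -S0 /wratio /cross.
  by apply/eqP; field; rewrite !Y0 lamc_neq0.
have XE : X p q = lamc p q * (Y p q.+1 * Y p.+1 q) * (1 + wratio m.+1 Y p q) /
   Z p.+1 q.+1.
  rewrite -[LHS](mulfK (Z0 p.+1 q.+1)) rec; congr (_ / _).
  by rewrite /wratio /cross; field; rewrite !Y0 lamc_neq0.
rewrite XE !expfzMl exprz_inv.
rewrite (@min_add_max m) ?pm //; last by rewrite -ltnS pm.
have -> : b p q.+1 + b p.+1 q - lower_max b p q - b p.+1 q =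
   b p q.+1 - lower_max b p q by ring.
have -> : b p q + 1 - (b p q.+1 + b p.+1 q - lower_max b p q) =
   d2 b p q + (lower_max b p q + 1 - b p.+1 q.+1) by rewrite /d2; ring.
rewrite [lamc p q ^ (d2 _ _ _ + _)]expfzDr ?lamc_neq0 //.
have e3 : d2 b p q \in [:: 0; 1; -1].
  have [] := height_cell p q hb; rewrite /d2 !inE; lia.
(* Since [d2 b p q] is 0, 1 or -1, multiplying by this power trades the factors at entries -1 for
   factors at entries 1. *)
have -> : (1 + wratio m.+1 Y p q) ^+ (d2 b p q == 1) =
  (1 + wratio m.+1 Y p q) ^ d2 b p q * (1 + wratio m.+1 Y p q) ^+ (d2 b p q == -1).
  move: e3; rewrite !inE => /or3P[] /eqP ->; rewrite ?mul1r ?mulr1 //=.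
  by rewrite exprN1 mulVf.
ring.
Qed.
End Weights.

(** * Finite encoding of corner sums; interlacing seen from either side *)

Definition hgrid (m : nat) := {ffun 'I_m.+1 * 'I_m.+1 -> 'I_m.+1}.

(* Clamping the indices makes [hv f] the corner-sum function of the matrix
   padded with zeros. *)
Definition hv (m : nat) (f : hgrid m) (i j : nat) : int :=
  (f (inord (minn i m), inord (minn j m)) : nat)%:Z.

Lemma hvE m (f : hgrid m) (v : 'I_m.+1 * 'I_m.+1) : hv f v.1 v.2 = (f v)%:Z.
Proof.
rewrite /hv; congr (Posz (nat_of_ord (f _))); case: v => i j /=; congr (_, _);
  by apply: val_inj; rewrite /= inordK; have := ltn_ord i; have := ltn_ord j; lia.
Qed.

Lemma hv_clampi m (f : hgrid m) i j : (m <= i)%N -> hv f i j = hv f m j.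
Proof. by move=> mi; rewrite /hv minnn (minn_idPr mi). Qed.

Lemma hv_clampj m (f : hgrid m) i j : (m <= j)%N -> hv f i j = hv f i m.
Proof. by move=> mj; rewrite /hv minnn (minn_idPr mj). Qed.

Definition heightb m (f : hgrid m) : bool :=
  [forall i : 'I_m.+1, forall j : 'I_m.+1,
    [&& hv f i 0 == 0, hv f 0 j == 0, hv f i m == i, hv f m j == j,
        hv f i j <= hv f i.+1 j <= hv f i j + 1 &
        hv f i j <= hv f i j.+1 <= hv f i j + 1]].

Lemma heightP m (f : hgrid m) : reflect (height m (hv f)) (heightb f).
Proof.
apply: (iffP forallP) => [hf|hf i]; last first.
  apply/forallP => j; have := ltn_ord i; have := ltn_ord j; rewrite !ltnS => jm im.
  rewrite (height_i0 hf) (height_0j hf) (height_im hf) // (height_mj hf) //.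
  by rewrite (height_stepi hf) (height_stepj hf) !eqxx.
have hf' i j : (i <= m)%N -> (j <= m)%N ->
    [/\ hv f i 0 = 0, hv f 0 j = 0, hv f i m = i, hv f m j = j &
        hv f i j <= hv f i.+1 j <= hv f i j + 1 /\
        hv f i j <= hv f i j.+1 <= hv f i j + 1].
  move=> im jm; have im' : (i < m.+1)%N by []; have jm' : (j < m.+1)%N by [].
  by have /forallP/(_ (Ordinal jm'))/and5P[/eqP ? /eqP ? /eqP ? /eqP ? /andP[? ?]]
    := hf (Ordinal im').
have clamp i j : hv f i j = hv f (minn i m) (minn j m).
  by rewrite /hv -!minnA !minnn.
have steps i j : hv f i j <= hv f i.+1 j <= hv f i j + 1 /\
        hv f i j <= hv f i j.+1 <= hv f i j + 1.
  have := @hf' (minn i m) (minn j m) (geq_minr _ _) (geq_minr _ _).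
  case=> _ _ _ _ [] h1 h2; split.
    rewrite (clamp i) (clamp i.+1); case: (leqP m i) => im.
      by rewrite (minn_idPr (leqW im)); lia.
    by move: h1; rewrite (clamp (minn i m).+1) (minn_idPl (ltnW im)) -minnA minnn.
  rewrite (clamp i) (clamp i j.+1); case: (leqP m j) => jm.
    by rewrite (minn_idPr (leqW jm)); lia.
  by move: h2; rewrite (clamp _ (minn j m).+1) (minn_idPl (ltnW jm)) -minnA minnn.
split=> [i|j|i im|j jm|i j|i j|i j|i j].
- by rewrite clamp min0n; have [] := @hf' (minn i m) 0%N (geq_minr _ _) isT.
- by rewrite clamp min0n; have [] := @hf' 0%N (minn j m) isT (geq_minr _ _).
- by have [] := @hf' i 0%N im isT.
- by have [] := @hf' 0%N j isT jm.
- by case: (steps i j).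
- by case: (steps i j).
- exact: hv_clampi.
- exact: hv_clampj.
Qed.

(** The four inequalities of [interlace] solved for the larger array, with its forced border values
    imposed separately. *)
Definition upper_interlace m (c : nat -> nat -> int) (i j : nat) (x : int) : bool :=
  if (i == 0%N) || (j == 0%N) then x == 0 else
  if i == m.+1 then x == j else
  if j == m.+1 then x == i else
  [&& c i.-1 j <= x, c i j.-1 <= x, x <= c i j & x <= c i.-1 j.-1 + 1].

Definition upper_compat m (b c : nat -> nat -> int) : Prop :=
  forall i j, (i <= m.+1)%N -> (j <= m.+1)%N -> upper_interlace m c i j (b i j).

Lemma upper_compat_boundary m b c : upper_compat m b c -> boundary m.+1 b.
Proof.
move=> bc; split=> i im.
- by have := bc i 0%N im isT; rewrite /upper_interlace eqxx orbT => /eqP.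
- by have := bc 0%N i isT im; rewrite /upper_interlace eqxx => /eqP.
- have := bc i m.+1 im (leqnn _); rewrite /upper_interlace eqxx orbF.
  case: (eqVneq i 0%N) => [-> /eqP //|_].
  by case: (eqVneq i m.+1) => [-> /eqP //|_ /eqP].
- have := bc m.+1 i (leqnn _) im; rewrite /upper_interlace eqxx /=.
  by case: (eqVneq i 0%N) => [-> /eqP //|_ /eqP].
Qed.

Lemma upper_compat_compat m b c : height m c -> upper_compat m b c -> compat m b c.
Proof.
move=> hc bc p q pm qm; have [e1 e2 e3 e4] := upper_compat_boundary bc.
have c0 i j := height_le_i i j hc.
have [h1 h2 h3 h4] := height_cell p q hc.
have inn i j : (0 < i <= m)%N -> (0 < j <= m)%N ->
   [&& c i.-1 j <= b i j, c i j.-1 <= b i j, b i j <= c i j & b i j <= c i.-1 j.-1 + 1].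
  move=> im jm; have := bc i j; rewrite /upper_interlace !ifF; lia.
apply/and4P; split.
- case: p pm {h1 h2 h3 h4} => [|p] pm; first by rewrite e2 ?c0 //; have := c0 0%N q; lia.
  case: q qm => [|q] qm; first by rewrite e1; have := c0 p.+1 0%N; lia.
  by have := inn p.+1 q.+1; lia.
- case: (ltnP p m) => pm'; last first.
    have -> : p = m by lia.
    by rewrite e4 ?(height_mj hc) //; lia.
  case: (ltnP q m) => qm'; last first.
    have -> : q = m by lia.
    by rewrite e3 ?(height_im hc) //; lia.
  by have := inn p.+1 q.+1 => /=; lia.
- case: q qm {h1 h2 h3 h4} => [|q] qm; first by rewrite e1 ?(height_i0 hc) //; lia.
  case: (ltnP p m) => pm'; last first.
    have -> : p = m by lia.
    by rewrite e4 ?(height_mj hc) //; lia.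
  by have := inn p.+1 q.+1 => /=; lia.
- case: p pm {h1 h2 h3 h4} => [|p] pm; first by rewrite e2 ?(height_0j hc) //; lia.
  case: (ltnP q m) => qm'; last first.
    have -> : q = m by lia.
    by rewrite e3 ?(height_im hc) //; lia.
  by have := inn p.+1 q.+1 => /=; lia.
Qed.

(** Two neighbouring values of either array are both compared with a common value of the other one,
    which confines the step to 0 or 1. This permits exchanging the order of summation over
    interlacing pairs. *)
Lemma compat_swap m (b : hgrid m.+1) (c : hgrid m) :
  height m.+1 (hv b) /\ compat m (hv b) (hv c) <->
  height m (hv c) /\ upper_compat m (hv b) (hv c).
Proof.
split=> [[hb bc]|[hc ubc]].
  have [c1 c2 c3 c4] := compat_boundary hb bc.
  split.
    apply/heightP/forallP => i; apply/forallP => j.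
    have := ltn_ord i; have := ltn_ord j; rewrite !ltnS => jm im.
    rewrite c1 ?c2 ?c3 ?c4 // !eqxx /=; apply/andP; split.
      case: (ltnP i m) => im'; last by rewrite !(hv_clampi c j) //; lia.
      have /and4P[? ? ? ?] := bc i j im jm.
      have /and4P[? ? ? ?] := bc i.+1 j im' jm; lia.
    case: (ltnP j m) => jm'; last by rewrite !(hv_clampj c i) //; lia.
    have /and4P[? ? ? ?] := bc i j im jm.
    have /and4P[? ? ? ?] := bc i j.+1 im jm'; lia.
  move=> i j im jm; rewrite /upper_interlace.
  case: ifP => [/orP[] /eqP ->|ij0]; rewrite ?(height_0j hb) ?(height_i0 hb) //.
  case: eqP => [->|i1]; first by rewrite (height_mj hb).
  case: eqP => [->|j1]; first by rewrite (height_im hb).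
  have := bc i.-1 j; have := bc i j.-1; have := bc i j; have := bc i.-1 j.-1.
  by rewrite /interlace !prednK; lia.
have bc := upper_compat_compat hc ubc.
have [e1 e2 e3 e4] := upper_compat_boundary ubc.
split=> //; apply/heightP/forallP => i; apply/forallP => j.
have := ltn_ord i; have := ltn_ord j; rewrite !ltnS => jm im.
rewrite e1 ?e2 ?e3 ?e4 // !eqxx /=; apply/andP; split.
  case: (ltnP i m.+1) => im'; last by rewrite !(hv_clampi b j) //; lia.
  apply/andP; split.
    case: (ltnP j m.+1) => jm'; first by have /and4P[? ? ? ?] := bc i j im' jm'; lia.
    have -> : (j = m.+1 :> nat) by lia.
    by rewrite !e3; lia.
  case: (nat_of_ord j) jm => [|k] km; first by rewrite !e1; lia.
  by have /and4P[? ? ? ?] := bc i k im' km; lia.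
case: (ltnP j m.+1) => jm'; last by rewrite !(hv_clampj b i) //; lia.
apply/andP; split.
  case: (ltnP i m.+1) => im'; first by have /and4P[? ? ? ?] := bc i j im' jm'; lia.
  have -> : (i = m.+1 :> nat) by lia.
  by rewrite !e4; lia.
case: (nat_of_ord i) im => [|k] km; first by rewrite !e2; lia.
by have /and4P[? ? ? ?] := bc k j km jm'; lia.
Qed.

(** Interlacing constrains each position separately, so the partners of a fixed array form a product
    set, over which sums of products factor. *)
Definition lower_fam m (b : hgrid m.+1) (v : 'I_m.+1 * 'I_m.+1) : pred 'I_m.+1 :=
  fun x => interlace (hv b) v.1 v.2 (x : nat)%:Z.

Definition upper_fam m (c : hgrid m) (v : 'I_m.+2 * 'I_m.+2) : pred 'I_m.+2 :=
  fun x => upper_interlace m (hv c) v.1 v.2 (x : nat)%:Z.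

Lemma lower_famP m (b : hgrid m.+1) (c : hgrid m) :
  reflect (compat m (hv b) (hv c)) (c \in family (lower_fam b)).
Proof.
apply: (iffP familyP) => [bc p q pm qm|bc v].
  have pm' : (p < m.+1)%N by []; have qm' : (q < m.+1)%N by [].
  have := bc (Ordinal pm', Ordinal qm').
  by rewrite -[_ \in _]/(lower_fam b _ _) /lower_fam -hvE.
by rewrite -[_ \in _]/(lower_fam b v _) /lower_fam -hvE; apply: bc; rewrite -ltnS ltn_ord.
Qed.

Lemma upper_famP m (b : hgrid m.+1) (c : hgrid m) :
  reflect (upper_compat m (hv b) (hv c)) (b \in family (upper_fam c)).
Proof.
apply: (iffP familyP) => [bc p q pm qm|bc v].
  have pm' : (p < m.+2)%N by []; have qm' : (q < m.+2)%N by [].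
  have := bc (Ordinal pm', Ordinal qm').
  by rewrite -[_ \in _]/(upper_fam c _ _) /upper_fam -hvE.
by rewrite -[_ \in _]/(upper_fam c v _) /upper_fam -hvE; apply: bc; rewrite -ltnS ltn_ord.
Qed.

Lemma fam_swap m (b : hgrid m.+1) (c : hgrid m) :
  heightb b && (c \in family (lower_fam b)) =
  heightb c && (b \in family (upper_fam c)).
Proof.
apply/andP/andP => [[/heightP hb /lower_famP bc]|[/heightP hc /upper_famP bc]].
  by have [/heightP ? /upper_famP ?] := (compat_swap b c).1 (conj hb bc).
by have [/heightP ? /lower_famP ?] := (compat_swap b c).2 (conj hc bc).
Qed.

(** * Summation over interlacing partners *)

Lemma dprod_pair (F : fieldType) N (f : nat -> nat -> F) :
  dprod N f = \prod_(v : 'I_N * 'I_N) f v.1 v.2.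
Proof.
rewrite /dprod big_mkord -(pair_bigA _ (fun p q : 'I_N => f p q)) /=.
by apply: eq_bigr => p _; rewrite big_mkord.
Qed.

Lemma sum_one_or_two (F : fieldType) N (P : pred 'I_N) (f : nat -> F) l (two : bool) :
  (forall x : 'I_N, P x = (l <= x <= l + two)%N) -> (l + two < N)%N ->
  \sum_(x | P x) f x = f l + (if two then f l.+1 else 0).
Proof.
move=> PE lN.
transitivity (\sum_(l <= x < (l + two).+1) f x).
  rewrite (@big_nat_widen _ _ _ l _ N) // big_geq_mkord.
  by apply: eq_bigl => x; rewrite PE andbC ltnS.
case: two {PE lN}; first by rewrite addn1 big_nat_recr ?leqW //= big_nat1.
by rewrite addn0 big_nat1 addr0.
Qed.

Section Sums.
Variables (F : fieldType) (lam mu : int -> F).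
Hypotheses (lam0 : forall a, lam a != 0) (mu0 : forall a, mu a != 0).
Implicit Types X Y Z : nat -> nat -> F.

(** By [weight_lower] the summand is a product over positions; distributivity leaves one local sum
    per position, with two terms exactly at the entries -1. *)
Lemma sum_lower m X Y (b : hgrid m.+1) : (forall p q, Y p q != 0) ->
  height m.+1 (hv b) ->
  \sum_(c in family (lower_fam b)) weight lam mu m X Y (hv b) (hv c) =
  weight lam mu m X Y (hv b) (lower_max (hv b)) *
  dprod m.+1 (fun p q => (1 + wratio lam mu m.+1 Y p q) ^+ (d2 (hv b) p q == -1)).
Proof.
move=> Y0 hb.
rewrite (eq_bigr (fun c : hgrid m => weight lam mu m X Y (hv b) (lower_max (hv b)) *
   \prod_(v : 'I_m.+1 * 'I_m.+1)
      wratio lam mu m.+1 Y v.1 v.2 ^ (lower_max (hv b) v.1 v.2 - (c v : nat)%:Z))); last first.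
  move=> c /lower_famP bc; rewrite (weight_lower lam0 mu0 X Y0 hb bc) dprod_pair.
  by congr (_ * _); apply: eq_bigr => v _; rewrite hvE.
rewrite -mulr_sumr; congr (_ * _); rewrite dprod_pair.
rewrite -(bigA_distr_big_dep (lower_fam b) (fun v x =>
  wratio lam mu m.+1 Y v.1 v.2 ^ (lower_max (hv b) v.1 v.2 - (x : nat)%:Z))).
apply: eq_bigr => -[p q] _ /=.
have [h1 h2 h3 h4] := height_cell p q hb.
have b00 := height_le_i p q hb; have b01 := height_le_i p q.+1 hb.
have pm := ltn_ord p.
set r := wratio _ _ _ _ _ _; set B := hv b in h1 h2 h3 h4 b00 b01 *.
set two := d2 B p q == -1.
(* The top value [lower_max] contributes 1, and the value one below, when allowed, contributes
   [r]. *)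
rewrite (@sum_one_or_two _ _ _ (fun x => r ^ (lower_max B p q - x%:Z))
  `|lower_max B p q - two|%N two).
- rewrite (_ : lower_max B p q - _ = two%:Z); last by rewrite /two /d2 /lower_max; lia.
  case twoE: two; last by rewrite addr0 expr0z.
  rewrite expr1z expr1 (_ : _ - _ = 0) ?expr0z 1?addrC //.
  by move: twoE; rewrite /two /d2 /lower_max; lia.
- by move=> x; rewrite /lower_fam /interlace /= -/B /two /d2 /lower_max; lia.
- by rewrite /two /d2 /lower_max; lia.
Qed.

Lemma sum_upper m Y Z (b : hgrid m.+1) : (forall p q, Y p q != 0) ->
  height m.+1 (hv b) ->
  \sum_(b' in family (upper_fam b)) weight lam mu m.+1 Y Z (hv b') (hv b) =
  weight lam mu m.+1 Y Z (upper_min m.+2 (hv b)) (hv b) *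
  dprod m.+1 (fun p q => (1 + wratio lam mu m.+1 Y p q) ^+ (d2 (hv b) p q == 1)).
Proof.
move=> Y0 hb; have [e1 e2 e3 e4] := upper_min_boundary hb.
(* Border values are forced, so [G] is 1 there; interior positions correspond to the cells of [b]
   after a shift by (1, 1). *)
pose G (v : 'I_m.+3 * 'I_m.+3) (x : int) : F :=
  if (0 < v.1 < m.+2)%N && (0 < v.2 < m.+2)%N then
     wratio lam mu m.+1 Y v.1.-1 v.2.-1 ^ (x - upper_min m.+2 (hv b) v.1 v.2)
  else 1.
have GE f : dprod m.+1 (fun p q => f p q) = \prod_(v : 'I_m.+3 * 'I_m.+3)
  (if (0 < v.1 < m.+2)%N && (0 < v.2 < m.+2)%N then f v.1.-1 v.2.-1 else 1) :> F.
  rewrite -(dprod_pair _ (fun p q => if (0 < p < m.+2)%N && (0 < q < m.+2)%N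
    then f p.-1 q.-1 else 1)).
  rewrite [RHS]dprod_ff => [|p _|q _]; [|by rewrite ?ltnn ?andbF|by rewrite ?ltnn].
  rewrite [RHS]dprod_ll => [|p _|q _]; [|by rewrite ?ltnn ?andbF|by rewrite ?ltnn].
  by apply: eq_dprod => p q pm qm; rewrite /= ifT //; lia.
rewrite (eq_bigr (fun b' : hgrid m.+2 =>
   weight lam mu m.+1 Y Z (upper_min m.+2 (hv b)) (hv b) *
   \prod_(v : 'I_m.+3 * 'I_m.+3) G v (b' v : nat)%:Z)); last first.
  move=> c /upper_famP /upper_compat_boundary bc.
  rewrite (weight_upper lam0 mu0 Z Y0 hb bc) GE.
  congr (_ * _); apply: eq_bigr => v _; rewrite /G -hvE; case: ifP => //.
  by case/andP=> /andP[v1 _] /andP[v2 _]; rewrite !prednK.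
rewrite -mulr_sumr; congr (_ * _); rewrite GE.
rewrite -(bigA_distr_big_dep (upper_fam b) (fun v x => G v (x : nat)%:Z)).
apply: eq_bigr => -[p q] _ /=.
have pm := ltn_ord p; have qm := ltn_ord q.
set B := hv b in hb e1 e2 e3 e4 *.
case: ifP => [/andP[p0 q0]|out]; last first.
  (* [k] is the forced border value, with the cases in the order of [upper_interlace]. *)
  pose k : nat := if p == 0%N :> nat then 0%N else if q == 0%N :> nat then 0%N else
                  if p == m.+2 :> nat then q else p.
  rewrite (@sum_one_or_two _ _ _ (fun x => G (p, q) x%:Z) k false).
  - by rewrite /G /= out addr0.
  - move=> x; rewrite /upper_fam /upper_interlace /= /k.
    by case: (eqVneq (p : nat) 0%N) => ?; case: (eqVneq (q : nat) 0%N) => ? /=;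
      case: (eqVneq (p : nat) m.+2) => ? /=; case: (eqVneq (q : nat) m.+2) => ? /=; lia.
  - by rewrite /k; do !case: ifP => ?; lia.
have [h1 h2 h3 h4] := height_cell p.-1 q.-1 hb.
have b00 := height_le_i p.-1 q.-1 hb; have b01 := height_le_i p.-1 q hb.
rewrite !prednK in h1 h2 h3 h4; [|lia..].
pose two := d2 B p.-1 q.-1 == 1.
have twoE : two = (B p q - B p.-1 q - B p q.-1 + B p.-1 q.-1 == 1).
  by rewrite /two /d2 !prednK //; lia.
have uE : upper_min m.+2 B p q = Num.max (B p q.-1) (B p.-1 q).
  by rewrite /upper_min ifF //; lia.
rewrite (@sum_one_or_two _ _ _ (fun x => G (p, q) x%:Z)
  `|upper_min m.+2 B p q|%N two).
- rewrite /G /= p0 q0 /= -/two.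
  rewrite (_ : `|upper_min m.+2 B p q|%:Z = upper_min m.+2 B p q); last by rewrite uE; lia.
  rewrite subrr expr0z; case twoE': two; last by rewrite addr0 expr0.
  rewrite expr1 -[in RHS](expr1z (wratio _ _ _ _ _ _)); congr (_ + _ ^ _).
  by rewrite uE; lia.
- move=> x; rewrite /upper_fam /upper_interlace /= -/B twoE uE.
  by rewrite !ifF; lia.
- by rewrite twoE uE; lia.
Qed.

(** Stage [m] of the expansion, where [X s] is the array of size [s] formed by one level of [T]. *)
Definition pair_sum (X : nat -> nat -> nat -> F) m : F :=
  \sum_(b : hgrid m.+1 | heightb b) \sum_(c in family (lower_fam b))
    weight lam mu m (X m.+1) (X m.+2) (hv b) (hv c).

Lemma pair_sumS (X : nat -> nat -> nat -> F) m :
  (forall m p q, X m p q != 0) ->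
  (forall p q, X m.+1 p q * X m.+3 p.+1 q.+1 =
     muc mu m.+1 p q * X m.+2 p q * X m.+2 p.+1 q.+1 +
     lamc lam p q * X m.+2 p q.+1 * X m.+2 p.+1 q) ->
  pair_sum X m = pair_sum X m.+1.
Proof.
move=> X0 rec; rewrite /pair_sum.
(* On the right the array of size [m + 1] is the smaller of the pair; summing over it last gives
   both sides the same outer index. *)
rewrite [RHS](exchange_big_dep (@heightb m.+1)) /=; last first.
  by move=> b' b hb' hb; have := fam_swap b' b; rewrite hb' hb => /esym/andP[].
apply: eq_bigr => b hb; have /heightP hb' := hb.
rewrite (sum_lower _ (X0 m.+2) hb').
rewrite (weight_exchange lam0 (X0 m.+1) (X0 m.+2) (X0 m.+3) rec hb').
rewrite -(sum_upper _ (X0 m.+2) hb'); apply: eq_bigl => b'.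
by rewrite fam_swap hb.
Qed.

(** Sizes 1 and 0 admit a single array each, and the only factor left is [X 1 0 0] to the power
    1. *)
Lemma pair_sum0 (X : nat -> nat -> nat -> F) : pair_sum X 0 = X 1%N 0%N 0%N.
Proof.
pose b0 : hgrid 1 := [ffun v : 'I_2 * 'I_2 => inord (v.1 * v.2)].
have b0E i j : (i <= 1)%N -> (j <= 1)%N -> hv b0 i j = (i * j)%N.
  move=> i1 j1; rewrite /hv ffunE /= !inordK ?(minn_idPl _) // ?ltnS //.
  by rewrite (leq_mul i1 j1).
have hE b : heightb b = (b == b0).
  apply/heightP/eqP => [hb|->].
    apply/ffunP => v; apply: val_inj; apply/eqP; rewrite -eqz_nat -!hvE; apply/eqP.
    case: v => -[[|[|i]] //= i1] [[|[|j]] //= j1]; rewrite b0E //=.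
    - by rewrite (height_0j hb).
    - by rewrite (height_0j hb).
    - by rewrite (height_i0 hb).
    - by rewrite (height_im hb).
  apply/heightP/forallP => -[[|[|i]] //= i1]; apply/forallP => -[[|[|j]] //= j1];
    by rewrite ?(@hv_clampi _ b0 2) ?(@hv_clampj _ b0 _ 2) // !b0E.
rewrite /pair_sum (eq_bigl _ _ hE) big_pred1_eq.
have cE (c : hgrid 0) : c \in family (lower_fam b0).
  apply/lower_famP => -[|p] // [|q] // _ _.
  have -> : hv c 0 0 = 0 by rewrite /hv; case: (c _) => -[|k].
  by rewrite /interlace !b0E.
rewrite (eq_bigl (pred1 ([ffun=> ord0] : hgrid 0))) => [|c]; last first.
  by rewrite cE /=; apply/esym/eqP/ffunP => v; rewrite ffunE; apply: ord1.
rewrite big_pred1_eq /weight /pweight /dprod !big_nat1 !big_geq // !mulr1.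
by rewrite /d2 !b0E.
Qed.
End Sums.

(** * Alternating sign matrices and corner sums *)

Definition sign_entries (s : seq int) := all (fun x => x \in [:: 0; 1; -1]) s.

(** A partial sum within range is 1 after an entry 1 and 0 after an entry -1, so a repeated sign is
    exactly what pushes it out of range. *)
Lemma alternatingP (s : seq int) : sign_entries s ->
  reflect ((forall k, 0 <= \sum_(x <- take k s) x <= 1) /\ \sum_(x <- s) x = 1)
    (alternating s).
Proof.
move=> sgn_s.
(* The last nonzero entry z read so far is recorded by the partial sum u. *)
have gen z u : (z, u) \in [:: (-1, 0); (1, 1)] ->
  reflect ((forall k, 0 <= u + \sum_(x <- take k s) x <= 1) /\
           u + \sum_(x <- s) x = 1 :> int)
   (path (fun x y => y == - x) z [seq x <- s | x != 0] &&
     (last z [seq x <- s | x != 0] == 1 :> int)).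
  elim: s sgn_s z u => [|y s IH] sgn_s z u zu.
    apply: (iffP idP) => [|[_]]; rewrite /= ?big_nil ?addr0.
      by move=> /eqP zE; move: zu; rewrite zE !inE => /orP[] /eqP[] // ->; split=> // k;
        rewrite big_nil.
    by move=> uE; move: zu; rewrite uE !inE => /orP[] /eqP[] // ->.
  move: sgn_s => /= /andP[sy sgn_s].
  have sumE : (forall k, 0 <= u + \sum_(x <- take k (y :: s)) x <= 1) /\
           u + \sum_(x <- y :: s) x = 1 <->
      [/\ 0 <= u <= 1, forall k, 0 <= (u + y) + \sum_(x <- take k s) x <= 1 &
           (u + y) + \sum_(x <- s) x = 1].
    split=> [[hk h]|[h0 hk h]].
      split=> [|k|]; first by have := hk 0%N; rewrite take0 big_nil addr0.
        by have := hk k.+1; rewrite /= big_cons addrA.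
      by move: h; rewrite big_cons addrA.
    split=> [[|k]|]; rewrite /= ?big_nil ?big_cons ?addr0 ?addrA //.
  have u01 : 0 <= u <= 1 by move: zu; rewrite !inE => /orP[] /eqP[_ ->].
  have [y0|y0 /=] := eqVneq y 0.
    apply: (iffP (IH sgn_s z u zu)); first by case=> h1 h2; apply/sumE; rewrite y0 addr0.
    by case/sumE => _; rewrite y0 addr0.
  have [yz|yz] := eqVneq y (- z).
    have yu : (y, u + y) \in [:: (-1, 0); (1, 1) : int * int].
      by move: zu; rewrite yz !inE => /orP[] /eqP[-> ->].
    apply: (iffP (IH sgn_s y (u + y) yu)); first by case=> h1 h2; apply/sumE.
    by case/sumE.
  apply: ReflectF => /sumE[_ hk _]; have := hk 0%N; rewrite take0 big_nil addr0.
  move: zu sy y0 yz; rewrite !inE => /orP[] /eqP[-> ->] /or3P[] /eqP -> //.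
(* A fictitious -1 in front, with partial sum 0, forces the first nonzero entry to be 1 and rules
   out the zero sequence. *)
suff -> : alternating s = (path (fun x y => y == - x) (-1) [seq x <- s | x != 0] &&
     (last (-1) [seq x <- s | x != 0] == 1)).
  apply: (iffP (gen (-1) 0 isT)) => -[h1 h2]; split=> [k|]; have := h1 0%N;
    first [have := h1 k | move: h2]; rewrite ?add0r //.
rewrite /alternating; case: [seq x <- s | x != 0] => //= x t.
by rewrite opprK; case: (x == 1); rewrite //= andbC.
Qed.

Section CornerSums.
Variable n : nat.
Implicit Type B : 'M[int]_n.

Definition mx_entry B (p q : nat) : int :=
  if @insub nat (fun k => (k < n)%N) 'I_n p is Some p' then
    if @insub nat (fun k => (k < n)%N) 'I_n q is Some q' then B p' q' else 0
  else 0.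

Lemma mx_entryE B (p q : 'I_n) : mx_entry B p q = B p q.
Proof. by rewrite /mx_entry !valK. Qed.

Lemma mx_entry_out B p q : (n <= p)%N || (n <= q)%N -> mx_entry B p q = 0.
Proof.
rewrite /mx_entry => pq; case: insubP => [p' _ p'E|//]; case: insubP => [q' _ q'E|//].
by move: pq; rewrite -p'E -q'E leqNgt ltn_ord /= leqNgt ltn_ord.
Qed.

Definition corner_sum B (i j : nat) : int :=
  \sum_(0 <= p < i) \sum_(0 <= q < j) mx_entry B p q.

Lemma corner_sumSi B i j :
  corner_sum B i.+1 j = corner_sum B i j + \sum_(0 <= q < j) mx_entry B i q.
Proof. by rewrite /corner_sum big_nat_recr. Qed.

Lemma corner_sumSj B i j :
  corner_sum B i j.+1 = corner_sum B i j + \sum_(0 <= p < i) mx_entry B p j.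
Proof.
by rewrite /corner_sum -big_split /=; apply: eq_bigr => p _; rewrite big_nat_recr.
Qed.

Lemma d2_corner_sum B p q : d2 (corner_sum B) p q = mx_entry B p q.
Proof. by rewrite /d2 !corner_sumSi big_nat_recr //=; ring. Qed.

Lemma sum_row_take (f : nat -> int) k :
  \sum_(x <- take k [seq f j | j : 'I_n <- enum 'I_n]) x =
  \sum_(0 <= j < minn k n) f j.
Proof.
have -> : [seq f j | j : 'I_n <- enum 'I_n] = [seq f j | j <- iota 0 n].
  by rewrite -val_enum_ord -map_comp.
rewrite -map_take take_iota big_map /index_iota subn0; congr bigop; congr iota.
Qed.

Lemma sum_row (f : nat -> int) :
  \sum_(x <- [seq f j | j : 'I_n <- enum 'I_n]) x = \sum_(0 <= j < n) f j.
Proof.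
by rewrite -[X in \sum_(x <- X) _](@take_oversize _ n) ?sum_row_take ?minnn //
  size_map size_enum_ord.
Qed.

Lemma is_asmP B :
  reflect [/\ forall p q, mx_entry B p q \in [:: 0; 1; -1],
     forall p k, 0 <= \sum_(0 <= q < k) mx_entry B p q <= 1,
     forall q k, 0 <= \sum_(0 <= p < k) mx_entry B p q <= 1,
     forall p, (p < n)%N -> \sum_(0 <= q < n) mx_entry B p q = 1 &
     forall q, (q < n)%N -> \sum_(0 <= p < n) mx_entry B p q = 1] (is_asm B).
Proof.
have rowE p : [seq B p j | j <- enum 'I_n] = [seq mx_entry B p j | j : 'I_n <- enum 'I_n].
  by apply: eq_map => j; rewrite mx_entryE.
have colE q : [seq B i q | i <- enum 'I_n] = [seq mx_entry B i q | i : 'I_n <- enum 'I_n].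
  by apply: eq_map => j; rewrite mx_entryE.
have trunc (f : nat -> int) k : (forall j, (n <= j)%N -> f j = 0) ->
    \sum_(0 <= j < k) f j = \sum_(0 <= j < minn k n) f j.
  move=> f0; rewrite (@big_cat_nat _ _ _ (minn k n) 0 k) ?geq_minl //=.
  by rewrite [X in _ + X]big_nat [X in _ + X]big1 ?addr0 // => j jk; apply: f0; lia.
have sgnr p : (forall p q, B p q \in [:: 0; 1; -1]) ->
     sign_entries [seq B p j | j <- enum 'I_n].
  by move=> h; rewrite /sign_entries all_map; apply/allP => j _; apply: h.
have sgnc q : (forall p q, B p q \in [:: 0; 1; -1]) ->
     sign_entries [seq B i q | i <- enum 'I_n].
  by move=> h; rewrite /sign_entries all_map; apply/allP => j _; apply: h.
apply: (iffP and3P) => [[/forallP sB /forallP rB /forallP cB]|[sB r1 c1 r2 c2]].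
  have sB' p q : B p q \in [:: 0; 1; -1] by have /forallP := sB p; apply.
  have rB' p := elimT (alternatingP (sgnr p sB')) (rB p).
  have cB' p := elimT (alternatingP (sgnc p sB')) (cB p).
  have r1 (p : 'I_n) k : 0 <= \sum_(0 <= q < k) mx_entry B p q <= 1.
    have [h _] := rB' p; have := h k; rewrite rowE sum_row_take -trunc // => j jn.
    by rewrite mx_entry_out ?jn ?orbT.
  have c1 (q : 'I_n) k : 0 <= \sum_(0 <= p < k) mx_entry B p q <= 1.
    have [h _] := cB' q; have := h k.
    rewrite colE (sum_row_take (fun i => mx_entry B i q)) -trunc // => j jn.
    by rewrite mx_entry_out ?jn.
  split.
  - move=> p q; rewrite /mx_entry; case: insubP => // p' _ _; case: insubP => // q' _ _.
  - move=> p k; case: (ltnP p n) => pn; first exact: (r1 (Ordinal pn)).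
    by rewrite big1 // => q _; rewrite mx_entry_out ?pn.
  - move=> q k; case: (ltnP q n) => qn; first exact: (c1 (Ordinal qn)).
    by rewrite big1 // => p _; rewrite mx_entry_out ?qn ?orbT.
  - by move=> p pn; have [_] := rB' (Ordinal pn); rewrite rowE sum_row.
  - move=> q qn; have [_] := cB' (Ordinal qn).
    by rewrite colE (sum_row (fun i => mx_entry B i q)).
have sB' p q : B p q \in [:: 0; 1; -1] by rewrite -mx_entryE.
split; apply/forallP => p; first by apply/forallP => q.
  apply/(alternatingP (sgnr p sB')); split=> [k|]; rewrite rowE ?sum_row_take //.
  by rewrite sum_row r2.
apply/(alternatingP (sgnc p sB')); split=> [k|]; rewrite colE.
  by rewrite (sum_row_take (fun i => mx_entry B i p)).
by rewrite (sum_row (fun i => mx_entry B i p)) c2.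
Qed.

Lemma corner_sum_height B : is_asm B -> height n (corner_sum B).
Proof.
move=> /is_asmP[sB r1 c1 r2 c2].
split.
- by move=> i; rewrite /corner_sum big1 // => p _; rewrite big_geq.
- by move=> j; rewrite /corner_sum big_geq.
- elim=> [|i IH] im; first by rewrite /corner_sum big_geq.
  by rewrite corner_sumSi IH ?r2 //; lia.
- elim=> [|j IH] jm; first by rewrite /corner_sum big1 // => p _; rewrite big_geq.
  by rewrite corner_sumSj IH ?c2 //; lia.
- by move=> i j; rewrite corner_sumSi; have := r1 i j; lia.
- by move=> i j; rewrite corner_sumSj; have := c1 j i; lia.
- move=> i j ni; elim: i ni => [|i IH] ni; first by congr corner_sum; lia.
  case: (ltnP i n) => ni'; first by congr corner_sum; lia.
  by rewrite corner_sumSi IH // big1 ?addr0 // => q _; rewrite mx_entry_out ?ni'.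
- move=> i j nj; elim: j nj => [|j IH] nj; first by congr corner_sum; lia.
  case: (ltnP j n) => nj'; first by congr corner_sum; lia.
  by rewrite corner_sumSj IH // big1 ?addr0 // => q _; rewrite mx_entry_out ?nj' ?orbT.
Qed.

Definition mx_of_height (b : hgrid n) : 'M[int]_n := \matrix_(p, q) d2 (hv b) p q.

Lemma mx_entry_of_height b p q : height n (hv b) ->
  mx_entry (mx_of_height b) p q = d2 (hv b) p q.
Proof.
move=> hb; case: (ltnP p n) => pn; last by rewrite mx_entry_out ?(d2_out hb) ?pn.
case: (ltnP q n) => qn; last by rewrite mx_entry_out ?(d2_out hb) ?qn ?orbT.
by rewrite (mx_entryE _ (Ordinal pn) (Ordinal qn)) mxE.
Qed.

Lemma sum_d2_row h p k : (forall i, h i 0%N = 0) ->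
  \sum_(0 <= q < k) d2 h p q = h p.+1 k - h p k.
Proof.
move=> h0; elim: k => [|k IH]; first by rewrite big_geq // !h0.
by rewrite big_nat_recr //= IH /d2; ring.
Qed.

Lemma sum_d2_col h q k : (forall j, h 0%N j = 0) ->
  \sum_(0 <= p < k) d2 h p q = h k q.+1 - h k q.
Proof.
move=> h0; elim: k => [|k IH]; first by rewrite big_geq // !h0.
by rewrite big_nat_recr //= IH /d2; ring.
Qed.

Lemma mx_of_height_asm b : height n (hv b) -> is_asm (mx_of_height b).
Proof.
move=> hb; have i0 := height_i0 hb; have j0 := height_0j hb.
have eE p q := mx_entry_of_height p q hb.
have rE p k : \sum_(0 <= q < k) mx_entry (mx_of_height b) p q = hv b p.+1 k - hv b p k.
  by rewrite -sum_d2_row //; apply: eq_bigr => q _; rewrite eE.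
have cE q k : \sum_(0 <= p < k) mx_entry (mx_of_height b) p q = hv b k q.+1 - hv b k q.
  by rewrite -sum_d2_col //; apply: eq_bigr => p _; rewrite eE.
apply/is_asmP; split=> [p q|p k|q k|p pn|q qn].
- by rewrite eE !inE; have [] := height_cell p q hb; rewrite /d2; lia.
- by rewrite rE; have := height_stepi hb p k; lia.
- by rewrite cE; have := height_stepj hb k q; lia.
- by rewrite rE !(height_im hb) //; lia.
- by rewrite cE !(height_mj hb) //; lia.
Qed.

Lemma corner_sumK b i j : height n (hv b) -> corner_sum (mx_of_height b) i j = hv b i j.
Proof.
move=> hb; rewrite /corner_sum.
elim: i => [|i IH]; first by rewrite big_geq // (height_0j hb).
rewrite big_nat_recr //= IH.
rewrite (eq_bigr (d2 (hv b) i)) => [|q _]; last exact: mx_entry_of_height.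
by rewrite sum_d2_row; [ring | exact: height_i0 hb].
Qed.

Definition height_of_mx B : hgrid n :=
  [ffun v : 'I_n.+1 * 'I_n.+1 => inord `|corner_sum B v.1 v.2|%N].

Lemma hv_height_of_mx B i j : is_asm B -> hv (height_of_mx B) i j = corner_sum B i j.
Proof.
move=> aB; have hB := corner_sum_height aB.
have clamp : corner_sum B i j = corner_sum B (minn i n) (minn j n).
  case: (leqP n i) => ni; [rewrite (height_clampi hB) // | ];
  case: (leqP n j) => nj //; by rewrite (height_clampj hB).
rewrite /hv ffunE /= !inordK ?ltnS ?geq_minr // -?clamp.
  by have := height_le_i i j hB; lia.
by rewrite clamp; have := height_le_i (minn i n) (minn j n) hB; lia.
Qed.

(** Second differences and double summation are inverse to each other, so [mx_of_height] is a
    bijection. *)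
Lemma perm_asms :
  perm_eq (asms n) [seq mx_of_height b | b <- enum [pred b | heightb b]].
Proof.
apply: uniq_perm; first exact: asms_uniq.
  rewrite map_inj_in_uniq ?enum_uniq // => b b'.
  rewrite !mem_enum !inE => /heightP hb /heightP hb' E; apply/ffunP => v.
  by apply: val_inj; apply/eqP; rewrite -eqz_nat -!hvE -(corner_sumK _ _ hb) E corner_sumK.
move=> B; rewrite mem_asms; apply/idP/mapP => [aB|[b]]; last first.
  by rewrite mem_enum inE => /heightP hb ->; apply: mx_of_height_asm.
exists (height_of_mx B).
  rewrite mem_enum inE; apply/heightP.
  have [h1 h2 h3 h4 h5 h6 h7 h8] := corner_sum_height aB.
  by split=> *; rewrite !hv_height_of_mx //; auto.
apply/matrixP => p q; rewrite mxE /d2 !hv_height_of_mx //.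
by rewrite -[LHS]mx_entryE -d2_corner_sum.
Qed.

Lemma sum_asms (R : nmodType) (G : 'M[int]_n -> R) :
  \sum_(B <- asms n) G B = \sum_(b : hgrid n | heightb b) G (mx_of_height b).
Proof. by rewrite (perm_big _ perm_asms) /= big_map big_enum. Qed.

End CornerSums.

(** * Inversions read off the corner sums *)

Section FirstNonzero.
Variables (n : nat) (r : nat -> int).
Hypothesis r01 : forall k, 0 <= r k <= 1.
Let e k := r k.+1 - r k.

Lemma const_between i j : (i <= j)%N ->
  (forall k, (i <= k < j)%N -> e k = 0) -> r j = r i.
Proof.
elim: j => [|j IH] ij ek; first by congr r; lia.
move: ij; rewrite leq_eqVlt => /predU1P[<- //|ij].
by have := ek j; rewrite /e -IH //; [lia | move=> k kj; apply: ek; lia].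
Qed.

(** Partial sums at 0 after [q] must still rise to 1, and the first change is that rise; from 1 the
    first change can only be a descent. *)
Lemma first_one_after (q : 'I_n) : r n = 1 ->
  [exists j : 'I_n, [&& (q < j)%N, e j == 1 &
    [forall k : 'I_n, (q < k < j)%N ==> (e k == 0)]]] = (r q.+1 == 0).
Proof.
move=> rn; apply/existsP/eqP => [[j /and3P[qj /eqP ej /forallP ek]]|rq].
  rewrite -(@const_between q.+1 j) //.
    by have := r01 j; have := r01 j.+1; move: ej; rewrite /e; lia.
  move=> k kj; have kn : (k < n)%N by have := ltn_ord j; lia.
  by have /implyP/(_ kj)/eqP := ek (Ordinal kn).
have exj : exists j, (q < j < n)%N && (r j.+1 == 1).
  have qn : (q.+1 < n)%N.
    by rewrite ltn_neqAle ltn_ord andbT; apply: contra_eq_neq rq => ->; rewrite rn.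
  by exists n.-1; rewrite prednK ?rn; lia.
case: (ex_minnP exj) => j /andP[/andP[qj jn] /eqP rj] jmin.
have r0 k : (q < k <= j)%N -> r k = 0.
  case: k => [|k] kj; first lia.
  case: (eqVneq k q) => [->//|kq]; have := jmin k; have := r01 k.+1; lia.
exists (Ordinal jn); apply/and3P; split=> //=.
  by rewrite /e rj r0 //; lia.
by apply/forallP => k; apply/implyP => kj; rewrite /e !r0 //; lia.
Qed.

(** Mirror image: if [r p] is 1, the last change before [p] was a rise, since the sums start at
    0. *)
Lemma first_one_before (p : 'I_n) : r 0%N = 0 ->
  [exists j : 'I_n, [&& (j < p)%N, e j == 1 &
    [forall k : 'I_n, (j < k < p)%N ==> (e k == 0)]]] = (r p == 1).
Proof.
move=> r00; apply/existsP/eqP => [[j /and3P[jp /eqP ej /forallP ek]]|rp].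
  rewrite (@const_between j.+1 p) //.
    by have := r01 j; have := r01 j.+1; move: ej; rewrite /e; lia.
  move=> k kp; have kn : (k < n)%N by have := ltn_ord p; lia.
  by have /implyP/(_ kp)/eqP := ek (Ordinal kn).
have exj : exists j, (j < p)%N && (r j == 0).
  by exists 0%N; rewrite r00; case: (nat_of_ord p) rp => [|//]; rewrite r00.
have jbd j : (j < p)%N && (r j == 0) -> (j <= p)%N by lia.
case: (ex_maxnP exj jbd) => j /andP[jp /eqP rj] jmax.
have r1 k : (j < k <= p)%N -> r k = 1.
  move=> kj; case: (eqVneq k p) => [->//|kp].
  by have := jmax k; have := r01 k; lia.
have jn : (j < n)%N by have := ltn_ord p; lia.
exists (Ordinal jn); apply/and3P; split=> //=.
  by rewrite /e rj r1 //; lia.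
by apply/forallP => k; apply/implyP => kj; rewrite /e !r1 //; lia.
Qed.

End FirstNonzero.

Section Neighbours.
Variables (n : nat) (b : hgrid n).
Hypothesis hb : height n (hv b).
Let B := mx_of_height b.

Lemma right1_height (p q : 'I_n) : right1 B p q = (hv b p.+1 q.+1 == hv b p q.+1).
Proof.
pose r k := hv b p.+1 k - hv b p k.
have eE k : B p k = r k.+1 - r k by rewrite mxE /d2 /r; ring.
rewrite -subr_eq0 -(@first_one_after n r _ q).
- apply: eq_existsb => j; rewrite eE; congr [&& _, _ & _].
  by apply: eq_forallb => k; rewrite eE.
- by move=> k; have := height_stepi hb p k; rewrite /r; lia.
- by rewrite /r !(height_im hb); have := ltn_ord p; lia.
Qed.

Lemma below1_height (p q : 'I_n) : below1 B p q = (hv b p.+1 q.+1 == hv b p.+1 q).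
Proof.
pose r k := hv b k q.+1 - hv b k q.
have eE k : B k q = r k.+1 - r k by rewrite mxE /d2 /r; ring.
rewrite -subr_eq0 -(@first_one_after n r _ p).
- apply: eq_existsb => j; rewrite eE; congr [&& _, _ & _].
  by apply: eq_forallb => k; rewrite eE.
- by move=> k; have := height_stepj hb k q; rewrite /r; lia.
- by rewrite /r !(height_mj hb); have := ltn_ord q; lia.
Qed.

Lemma above1_height (p q : 'I_n) : above1 B p q = (hv b p q.+1 - hv b p q == 1).
Proof.
pose r k := hv b k q.+1 - hv b k q.
have eE k : B k q = r k.+1 - r k by rewrite mxE /d2 /r; ring.
rewrite -(@first_one_before n r _ p).
- apply: eq_existsb => j; rewrite eE; congr [&& _, _ & _].
  by apply: eq_forallb => k; rewrite eE.
- by move=> k; have := height_stepj hb k q; rewrite /r; lia.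
- by rewrite /r !(height_0j hb).
Qed.

End Neighbours.

(** * The weight of an alternating sign matrix, cell by cell *)

(** Grouping the cells by their diagonal turns the counts in the exponents into one factor per
    cell. *)
Lemma prod_diags (F : fieldType) n (f : int -> F) (P : pred ('I_n * 'I_n))
    (key : 'I_n * 'I_n -> int) :
  (forall v, P v -> key v \in diags n) ->
  \prod_(a <- diags n) f a ^+ #|[set v | P v && (key v == a)]| =
  \prod_v f (key v) ^+ P v.
Proof.
move=> Pkey.
transitivity (\prod_(a <- diags n) \prod_(v | P v && (key v == a)) f a).
  by apply: eq_bigr => a _; rewrite -prodr_const; apply: eq_bigl => v; rewrite inE.
rewrite (exchange_big_dep P) /=; last by move=> a v _ /andP[].
rewrite [RHS](bigID P) /= [X in _ * X]big1 ?mulr1; last first.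
  by move=> v /negbTE ->.
apply: eq_bigr => v Pv; rewrite Pv expr1.
rewrite (eq_bigl (pred1 (key v))) => [|a]; last by rewrite /= eq_sym.
rewrite -big_filter filter_pred1_uniq ?big_seq1 ?diags_uniq ?Pkey //.
Qed.

(** These bounds keep the diagonals of inversions within [diags]. *)
Lemma right1_lt n (B : 'M[int]_n) (p q : 'I_n) : right1 B p q -> (q.+1 < n)%N.
Proof. by case/existsP=> j /and3P[qj _ _]; apply: leq_ltn_trans qj (ltn_ord j). Qed.

Lemma below1_lt n (B : 'M[int]_n) (p q : 'I_n) : below1 B p q -> (p.+1 < n)%N.
Proof. by case/existsP=> j /and3P[qj _ _]; apply: leq_ltn_trans qj (ltn_ord j). Qed.

Lemma above1_gt n (B : 'M[int]_n) (p q : 'I_n) : above1 B p q -> (0 < p)%N.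
Proof. by case/existsP=> j /and3P[qj _ _]; apply: leq_ltn_trans qj. Qed.

Definition asm_weight (F : fieldType) n (A : 'M[F]_n) (lam mu : int -> F)
    (B : 'M[int]_n) : F :=
  (\prod_(a <- diags n) (lam a ^+ inv_diag B a * mu a ^+ inv_adiag B a)) *
      \prod_(i < n) \prod_(j < n)
        (A i j ^ B i j * (lam (cdiag i j) + mu (cadiag i j)) ^+ (B i j == -1)).

Lemma asm_weight_cells (F : fieldType) n (A : 'M[F]_n) (lam mu : int -> F)
    (B : 'M[int]_n) :
  asm_weight A lam mu B = \prod_(v : 'I_n * 'I_n)
    (lam (cdiag v.1 v.2) ^+ [&& B v.1 v.2 == 0, right1 B v.1 v.2 & below1 B v.1 v.2] *
     mu (cadiag v.1 v.2) ^+ [&& B v.1 v.2 == 0, right1 B v.1 v.2 & above1 B v.1 v.2] *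
     (A v.1 v.2 ^ B v.1 v.2 *
      (lam (cdiag v.1 v.2) + mu (cadiag v.1 v.2)) ^+ (B v.1 v.2 == -1))).
Proof.
rewrite /asm_weight (pair_bigA _ (fun i j => A i j ^ B i j *
   (lam (cdiag i j) + mu (cadiag i j)) ^+ (B i j == -1))) /= !big_split /=.
congr (_ * _ * _).
- rewrite -(@prod_diags _ _ lam (fun v => [&& B v.1 v.2 == 0, right1 B v.1 v.2 & below1 B v.1 v.2])
    (fun v => cdiag v.1 v.2)).
    apply: eq_bigr => a _; congr (_ ^+ _); apply: eq_card => v; rewrite !inE.
    by rewrite -!andbA; do !bool_congr.
  move=> [p q] /= /and3P[_ /right1_lt qn /below1_lt pn].
  by rewrite mem_diags /cdiag; lia.
- rewrite -(@prod_diags _ _ mu (fun v => [&& B v.1 v.2 == 0, right1 B v.1 v.2 & above1 B v.1 v.2])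
    (fun v => cadiag v.1 v.2)).
    apply: eq_bigr => a _; congr (_ ^+ _); apply: eq_card => v; rewrite !inE.
    by rewrite -!andbA; do !bool_congr.
  move=> [p q] /= /and3P[_ /right1_lt qn /above1_gt pn].
  by have := ltn_ord p; rewrite mem_diags /cadiag; lia.
Qed.

(** * The formula when no parameter and no [T] vanishes *)

Lemma TsysSS (F : fieldType) n (A : 'M[F]_n) (lam mu : int -> F) k i j :
  Tsys A lam mu k.+2 i j =
  (mu j * Tsys A lam mu k.+1 i (j + 1) * Tsys A lam mu k.+1 i (j - 1) +
   lam i * Tsys A lam mu k.+1 (i + 1) j * Tsys A lam mu k.+1 (i - 1) j) /
  Tsys A lam mu k i j.
Proof. by []. Qed.

Section NonVanishing.
Variables (F : fieldType) (lam mu : int -> F).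
Hypotheses (lam0 : forall a, lam a != 0) (mu0 : forall a, mu a != 0).

(** With [Y = 1] the ratio [wratio] is [mu / lam]. At an entry -1 the cell gives
    [lam * (1 + mu / lam) = lam + mu], at an entry 1 no parameter, and at an entry 0 the exponents
    are the indicators of the two kinds of inversion. *)
Lemma sum_lower_asm m (A : 'M[F]_m.+1) (X Y : nat -> nat -> F) (b : hgrid m.+1) :
  (forall p q : 'I_m.+1, X p q = A p q) -> (forall p q, Y p q = 1) ->
  height m.+1 (hv b) ->
  \sum_(c in family (lower_fam b)) weight lam mu m X Y (hv b) (hv c) =
  asm_weight A lam mu (mx_of_height b).
Proof.
move=> XA Y1 hb.
have Y0 p q : Y p q != 0 by rewrite Y1 oner_eq0.
rewrite (sum_lower lam0 mu0 X Y0 hb) /weight.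
rewrite [dprod m _]dprod1 ?mul1r => [|p q _ _]; last by rewrite Y1 exp1rz.
rewrite (pweight_lower_max lam mu hb) -!dprodM dprod_pair asm_weight_cells.
apply: eq_bigr => -[p q] _ /=.
have -> : muc mu m.+1 p q = mu (cadiag p q) by congr mu; rewrite /cadiag; lia.
have -> : lamc lam p q = lam (cdiag p q) by congr lam; rewrite /cdiag; lia.
have -> : wratio lam mu m.+1 Y p q = mu (cadiag p q) / lam (cdiag p q).
  rewrite /wratio /cross !Y1 !mulr1 invr1 !mulr1.
  by congr (_ / _); [congr mu; rewrite /cadiag | congr lam; rewrite /cdiag]; lia.
rewrite right1_height // below1_height // above1_height // XA mxE.
have l0 := lam0 (cdiag p q).
set B := hv b; set x := _ ^ _; set l := lam _ in l0 *; set k := mu _.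
have [h1 h2 h3 h4] := height_cell p q hb; rewrite -/B in h1 h2 h3 h4.
have : d2 B p q \in [:: 0; 1; -1] by rewrite !inE /d2; lia.
rewrite !inE => /or3P[] /eqP dE; rewrite /x dE /= ?expr0 ?mulr1 ?mul1r.
- have -> : B p q.+1 - lower_max B p q =
     ((B p.+1 q.+1 == B p q.+1) && (B p q.+1 - B p q == 1))%:Z.
    by move: dE; rewrite /d2 /lower_max; lia.
  have -> : lower_max B p q + 1 - B p.+1 q.+1 =
     ((B p.+1 q.+1 == B p q.+1) && (B p.+1 q.+1 == B p.+1 q))%:Z.
    by move: dE; rewrite /d2 /lower_max; lia.
  by rewrite -!exprnP mulrC.
- have -> : B p q.+1 - lower_max B p q = 0 by move: dE; rewrite /d2 /lower_max; lia.
  have -> : lower_max B p q + 1 - B p.+1 q.+1 = 0 by move: dE; rewrite /d2 /lower_max; lia.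
  by rewrite !expr0z !mulr1.
- have -> : B p q.+1 - lower_max B p q = 0 by move: dE; rewrite /d2 /lower_max; lia.
  have -> : lower_max B p q + 1 - B p.+1 q.+1 = 1 by move: dE; rewrite /d2 /lower_max; lia.
  rewrite expr0z expr1z mul1r !expr1 -mulrA; congr (_ * _).
  by field.
Qed.

Lemma lambda_det_nonvanishing n (A : 'M[F]_n) : (1 <= n)%N ->
  (forall k i j, Tsys A lam mu k i j != 0) ->
  lambda_det A lam mu = \sum_(B <- asms n) asm_weight A lam mu B.
Proof.
case: n A => [//|n] A _ T0.
(* The matrix now has size [n.+1]. [X 1] holds [T] at the top level, [X n.+1] the entries of [A],
   and [X n.+2] the constant level 0. *)
pose X m (p q : nat) := Tsys A lam mu (n.+2 - m) (q%:Z - p%:Z) ((p + q + 1)%:Z - m%:Z).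
have X0 m p q : X m p q != 0 by exact: T0.
have step m : (m < n)%N -> pair_sum lam mu X m = pair_sum lam mu X m.+1.
  move=> mn; apply: pair_sumS => // p q.
  rewrite /X.
  have -> : (n.+2 - m.+1 = (n - m.+1).+2)%N by lia.
  have -> : (n.+2 - m.+2 = (n - m.+1).+1)%N by lia.
  have -> : (n.+2 - m.+3 = n - m.+1)%N by lia.
  set k := (n - m.+1)%N.
  have -> : (p.+1 + q.+1 + 1)%:Z - m.+3%:Z = (p + q + 1)%:Z - m.+1%:Z by lia.
  have -> : q.+1%:Z - p.+1%:Z = q%:Z - p%:Z by lia.
  rewrite TsysSS divfK ?T0 // /muc /lamc.
  have -> : (p + q + 1)%:Z - m.+1%:Z + 1 = (p.+1 + q.+1 + 1)%:Z - m.+2%:Z by lia.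
  have -> : (p + q + 1)%:Z - m.+1%:Z - 1 = (p + q + 1)%:Z - m.+2%:Z by lia.
  have -> : q%:Z - p%:Z + 1 = q.+1%:Z - p%:Z by lia.
  have -> : q%:Z - p%:Z - 1 = q%:Z - p.+1%:Z by lia.
  have -> : (p + q.+1 + 1)%:Z - m.+2%:Z = (p + q + 1)%:Z - m.+1%:Z by lia.
  have -> : (p.+1 + q + 1)%:Z - m.+2%:Z = (p + q + 1)%:Z - m.+1%:Z by lia.
  by congr (_ + _); ring.
have -> : lambda_det A lam mu = X 1%N 0%N 0%N by rewrite /lambda_det /X subn1.
rewrite -(pair_sum0 lam mu X).
have -> : pair_sum lam mu X 0 = pair_sum lam mu X n.
  have: (n <= n)%N by []; elim: {-2}n => [//|m IH] mn.
  by rewrite -step // IH // ltnW.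
rewrite sum_asms /pair_sum; apply: eq_bigr => b /heightP hb.
apply: sum_lower_asm => //.
  move=> p q; rewrite /X subSS subSnn -(Tsys1_entry A lam mu p q).
  by congr Tsys; lia.
by move=> p q; rewrite /X subnn.
Qed.

End NonVanishing.

(** * Specialisation of rational functions at a point *)

Section Specialization.
Variables (F : fieldType) (c : F).
Implicit Types (x : {fraction {poly F}}) (y : F).

(** A relation rather than a function, since only fractions with a denominator nonzero at [c] have a
    value there. *)
Definition spec x y : Prop := exists p q : {poly F},
  [/\ q.[c] != 0, x = tofrac p / tofrac q & y = p.[c] / q.[c]].

Lemma tofrac_horner_neq0 (q : {poly F}) : q.[c] != 0 -> tofrac q != 0.
Proof. by rewrite tofrac_eq0; apply: contraNneq => ->; rewrite horner0. Qed.

Lemma spec_poly (p : {poly F}) : spec (tofrac p) p.[c].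
Proof. by exists p, 1; rewrite hornerC oner_eq0 rmorph1 !divr1. Qed.

Lemma spec1 : spec 1 1.
Proof. by have := spec_poly 1; rewrite rmorph1 hornerC. Qed.

Lemma spec0 : spec 0 0.
Proof. by have := spec_poly 0; rewrite rmorph0 hornerC. Qed.

Lemma specD x x' y y' : spec x y -> spec x' y' -> spec (x + x') (y + y').
Proof.
move=> [p [q [q0 -> ->]]] [r [s [s0 -> ->]]].
exists (p * s + r * q), (q * s); split.
- by rewrite hornerM mulf_neq0.
- by rewrite addf_div ?tofrac_horner_neq0 // rmorphD !rmorphM.
- by rewrite addf_div // hornerD !hornerM.
Qed.

Lemma specM x x' y y' : spec x y -> spec x' y' -> spec (x * x') (y * y').
Proof.
move=> [p [q [q0 -> ->]]] [r [s [s0 -> ->]]].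
exists (p * r), (q * s); split.
- by rewrite hornerM mulf_neq0.
- by rewrite mulf_div !rmorphM.
- by rewrite mulf_div !hornerM.
Qed.

Lemma specV x y : y != 0 -> spec x y -> spec x^-1 y^-1.
Proof.
move=> y0 [p [q [q0 xE yE]]]; exists q, p; rewrite xE yE !invf_div; split=> //.
by move: y0; rewrite yE; apply: contraNneq => ->; rewrite mul0r.
Qed.

Lemma spec_neq0 x y : spec x y -> y != 0 -> x != 0.
Proof.
move=> [p [q [q0 -> ->]]] pq0; rewrite mulf_neq0 ?invr_eq0 ?tofrac_horner_neq0 //.
by move: pq0; apply: contraNneq => ->; rewrite mul0r.
Qed.

Lemma spec_inj x y y' : spec x y -> spec x y' -> y = y'.
Proof.
move=> [p [q [q0 -> ->]]] [r [s [s0 /eqP E ->]]]; apply/eqP; rewrite eqr_div //.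
move: E; rewrite eqr_div ?tofrac_horner_neq0 // -!rmorphM tofrac_eq => /eqP E.
by rewrite -!hornerM E.
Qed.

Lemma specX x y k : spec x y -> spec (x ^+ k) (y ^+ k).
Proof.
move=> xy; elim: k => [|k IH]; first by rewrite !expr0; apply: spec1.
by rewrite !exprS; apply: specM.
Qed.

Lemma spec_prod (I : Type) (s : seq I) (f : I -> {fraction {poly F}}) (g : I -> F) :
  (forall i, spec (f i) (g i)) -> spec (\prod_(i <- s) f i) (\prod_(i <- s) g i).
Proof.
move=> fg; elim: s => [|i s IH]; first by rewrite !big_nil; apply: spec1.
by rewrite !big_cons; apply: specM.
Qed.

Lemma spec_sum (I : eqType) (s : seq I) (f : I -> {fraction {poly F}}) (g : I -> F) :
  {in s, forall i, spec (f i) (g i)} -> spec (\sum_(i <- s) f i) (\sum_(i <- s) g i).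
Proof.
elim: s => [|i s IH] fg; first by rewrite !big_nil; apply: spec0.
rewrite !big_cons; apply: specD; first by apply: fg; rewrite mem_head.
by apply: IH => j js; apply: fg; rewrite inE js orbT.
Qed.

Lemma spec_entry1 n (A' : 'M[{fraction {poly F}}]_n) (A : 'M[F]_n) r s :
  (forall i j, spec (A' i j) (A i j)) -> spec (entry1 A' r s) (entry1 A r s).
Proof.
move=> AA; rewrite /entry1; case: r => [[|r]|r]; try exact: spec1.
case: s => [[|s]|s]; try exact: spec1.
case: insubP => [p _ _|_]; last exact: spec1.
case: insubP => [q _ _|_]; [exact: AA | exact: spec1].
Qed.

(** Specialisation passes through the divisions because [generic] keeps the denominators nonzero; it
    does so only on the indices visited from the top, hence the conditions on [i], [j], [k]. *)
Lemma spec_Tsys n (A' : 'M[{fraction {poly F}}]_n) (A : 'M[F]_n) lam' lam mu' mu :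
  (forall i j, spec (A' i j) (A i j)) ->
  (forall a, spec (lam' a) (lam a)) -> (forall a, spec (mu' a) (mu a)) ->
  generic A lam mu ->
  forall k i j, (i + j + k%:Z = n%:Z %[mod 2])%Z -> `|i| + `|j| + k%:Z <= n%:Z ->
  spec (Tsys A' lam' mu' k i j) (Tsys A lam mu k i j).
Proof.
move=> sA sl sm gA k.
(* The recursion reaches back two levels, so two consecutive levels are carried along. *)
suff: forall i j,
    ((i + j + k%:Z = n%:Z %[mod 2])%Z -> `|i| + `|j| + k%:Z <= n%:Z ->
      spec (Tsys A' lam' mu' k i j) (Tsys A lam mu k i j)) /\
    ((i + j + k.+1%:Z = n%:Z %[mod 2])%Z -> `|i| + `|j| + k.+1%:Z <= n%:Z ->
      spec (Tsys A' lam' mu' k.+1 i j) (Tsys A lam mu k.+1 i j)).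
  by move=> H i j; case: (H i j).
elim: k => [|k IH] i j; split=> par le_n; first exact: spec1.
- exact: spec_entry1.
- by case: (IH i j) => _; apply.
have [IHk _] := IH i j.
have [_ IH1] := IH i (j + 1); have [_ IH2] := IH i (j - 1).
have [_ IH3] := IH (i + 1) j; have [_ IH4] := IH (i - 1) j.
rewrite !TsysSS; apply: specM; last by apply: specV; [apply: gA | apply: IHk]; lia.
apply: specD; (apply: specM; first apply: specM) => //;
  by [apply: IH1; lia | apply: IH2; lia | apply: IH3; lia | apply: IH4; lia].
Qed.

End Specialization.

(** The partial sum drops from 1 to 0 at an entry -1, so it has risen before and must rise again, in
    the row and in the column. *)
Lemma asm_neg_interior n (B : 'M[int]_n) (p q : 'I_n) : is_asm B -> B p q = -1 ->
  [/\ (0 < p)%N, (p.+1 < n)%N, (0 < q)%N & (q.+1 < n)%N].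
Proof.
move=> /is_asmP[_ r1 c1 r2 c2] Bpq.
have pn := ltn_ord p; have qn := ltn_ord q.
have c3 : \sum_(0 <= k < p.+1) mx_entry B k q = \sum_(0 <= k < p) mx_entry B k q - 1.
  by rewrite big_nat_recr //= mx_entryE Bpq.
have r3 : \sum_(0 <= k < q.+1) mx_entry B p k = \sum_(0 <= k < q) mx_entry B p k - 1.
  by rewrite big_nat_recr //= mx_entryE Bpq.
have := c1 q p; have := c1 q p.+1; have := r1 p q; have := r1 p q.+1.
rewrite r3 c3 => h1 h2 h3 h4; split.
- by rewrite lt0n; apply/negP => /eqP E; move: h4 h3; rewrite E big_geq //; lia.
- rewrite ltn_neqAle pn andbT; apply/negP => /eqP E.
  by move: c3; rewrite E c2 //; lia.
- by rewrite lt0n; apply/negP => /eqP E; move: h1 h2; rewrite E big_geq //; lia.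
- rewrite ltn_neqAle qn andbT; apply/negP => /eqP E.
  by move: r3; rewrite E r2 //; lia.
Qed.

(** At level 1, [generic] speaks of the entries off the border, and no -1 lies on the border. *)
Lemma generic_entry_neq0 (F : fieldType) n (A : 'M[F]_n) lam mu (B : 'M[int]_n)
    (p q : 'I_n) :
  generic A lam mu -> is_asm B -> B p q = -1 -> A p q != 0.
Proof.
move=> gA aB /(asm_neg_interior aB)[p0 pn q0 qn].
by rewrite -(Tsys1_entry A lam mu p q); apply: gA; lia.
Qed.

Lemma spec_asm_weight (F : fieldType) c n (A' : 'M[{fraction {poly F}}]_n)
    (A : 'M[F]_n) lam' lam mu' mu (B : 'M[int]_n) :
  (forall i j, spec c (A' i j) (A i j)) ->
  (forall a, spec c (lam' a) (lam a)) -> (forall a, spec c (mu' a) (mu a)) ->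
  generic A lam mu -> is_asm B ->
  spec c (asm_weight A' lam' mu' B) (asm_weight A lam mu B).
Proof.
move=> sA sl sm gA aB; rewrite /asm_weight; apply: specM.
  by apply: spec_prod => a; apply: specM; apply: specX.
apply: spec_prod => i; apply: spec_prod => j; apply: specM; last first.
  by apply: specX; apply: specD.
have /and3P[/forallP/(_ i)/forallP/(_ j)] := aB.
rewrite !inE => /or3P[] /eqP Bij _ _; rewrite Bij; first exact: spec1.
  by rewrite !expr1z.
by rewrite !exprN1; apply: specV => //; apply: generic_entry_neq0 gA aB Bij.
Qed.

(** * Deformation of the data and the general case *)

Section Interpolation.
Variables (F : fieldType) (n : nat) (A : 'M[F]_n) (lam mu : int -> F).

Let K := {fraction {poly F}}.

Definition interp_mx : 'M[K]_n := \matrix_(i, j) tofrac ((A i j)%:P * (1 - 'X) + 'X).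
(* The factor ['X + lam a] keeps this nonzero even when [lam a = 0]. *)
Definition interp_lam a : K := tofrac ((1 - 'X) * ('X + (lam a)%:P)).
Definition interp_mu a : K := tofrac ((mu a)%:P * (1 - 'X) + 'X).

Lemma spec_interp0 : [/\ forall i j, spec 0 (interp_mx i j) (A i j),
  forall a, spec 0 (interp_lam a) (lam a) & forall a, spec 0 (interp_mu a) (mu a)].
Proof.
split=> [i j|a|a].
- by have := spec_poly 0 ((A i j)%:P * (1 - 'X) + 'X);
    rewrite mxE !hornerE ?subr0 ?mulr1 ?mul1r ?addr0 ?add0r.
- by have := spec_poly 0 ((1 - 'X) * ('X + (lam a)%:P));
    rewrite !hornerE ?subr0 ?mulr1 ?mul1r ?addr0 ?add0r.
- by have := spec_poly 0 ((mu a)%:P * (1 - 'X) + 'X);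
    rewrite !hornerE ?subr0 ?mulr1 ?mul1r ?addr0 ?add0r.
Qed.

Lemma spec_interp1 : [/\ forall i j, spec 1 (interp_mx i j) 1,
  forall a, spec 1 (interp_lam a) 0 & forall a, spec 1 (interp_mu a) 1].
Proof.
split=> [i j|a|a].
- by have := spec_poly 1 ((A i j)%:P * (1 - 'X) + 'X);
    rewrite mxE !hornerE subrr mulr0 add0r.
- by have := spec_poly 1 ((1 - 'X) * ('X + (lam a)%:P)); rewrite !hornerE subrr mul0r.
- by have := spec_poly 1 ((mu a)%:P * (1 - 'X) + 'X);
    rewrite !hornerE subrr mulr0 add0r.
Qed.

Lemma interp_lam_neq0 a : interp_lam a != 0.
Proof.
rewrite tofrac_eq0 mulf_neq0 //; last by rewrite -size_poly_gt0 size_XaddC.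
by rewrite -oppr_eq0 opprB polyXsubC_eq0.
Qed.

(** At [t = 1] the recursion only multiplies and divides ones, so every [T] takes the value 1 there
    and cannot be zero. *)
Lemma interp_Tsys_neq0 k i j : Tsys interp_mx interp_lam interp_mu k i j != 0.
Proof.
have [sA sl sm] := spec_interp1.
suff: spec 1 (Tsys interp_mx interp_lam interp_mu k i j) 1.
  by move/spec_neq0; apply; apply: oner_neq0.
suff: forall i j, spec 1 (Tsys interp_mx interp_lam interp_mu k i j) 1 /\
    spec 1 (Tsys interp_mx interp_lam interp_mu k.+1 i j) 1.
  by move=> H; case: (H i j).
elim: k {i j} => [|k IH] i j; split; first exact: spec1.
(* The default value of [entry1] is also 1, so indices outside the matrix need no separate
   treatment. *)
- have := @spec_entry1 _ 1 n interp_mx (const_mx 1) ((j - i + n%:Z + 1) %/ 2)%Z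
    ((i + j + n%:Z + 1) %/ 2)%Z.
  have -> r s : entry1 (const_mx 1 : 'M[F]_n) r s = 1.
    rewrite /entry1; case: r => [[|r]|r] //; case: s => [[|s]|s] //.
    by case: insubP => // ? _ _; case: insubP => // ? _ _; rewrite mxE.
  by apply=> i' j'; rewrite [X in spec _ _ X]mxE; apply: sA.
- by case: (IH i j).
rewrite TsysSS.
have [sk _] := IH i j; have [_ s1] := IH i (j + 1); have [_ s2] := IH i (j - 1).
have [_ s3] := IH (i + 1) j; have [_ s4] := IH (i - 1) j.
have := specM (specD (specM (specM (sm j) s1) s2) (specM (specM (sl i) s3) s4))
  (specV (oner_neq0 _) sk).
by rewrite !mul1r !mul0r addr0 invr1 mulr1.
Qed.

End Interpolation.

Theorem theorem6p4 (F : fieldType) (n : nat) (A : 'M[F]_n)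
    (lam mu : int -> F) (n_ge1 : (1 <= n)%N) (genA : generic A lam mu) :
  lambda_det A lam mu =
    \sum_(B <- asms n)
      (\prod_(a <- diags n) (lam a ^+ inv_diag B a * mu a ^+ inv_adiag B a)) *
      \prod_(i < n) \prod_(j < n)
        (A i j ^ B i j * (lam (cdiag i j) + mu (cadiag i j)) ^+ (B i j == -1)).
Proof.
have [sA sl sm] := spec_interp0 A lam mu.
have mu0 a : interp_mu mu a != 0.
  have [_ _ sm1] := spec_interp1 A lam mu.
  exact: spec_neq0 (sm1 a) (oner_neq0 _).
have E := lambda_det_nonvanishing (interp_lam_neq0 lam) mu0 n_ge1
  (interp_Tsys_neq0 A lam mu).
(* Both sides are values at [t = 0] of the same rational function, the deformed determinant. *)
apply: (@spec_inj _ 0 (lambda_det (interp_mx A) (interp_lam lam) (interp_mu mu))).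
  by apply: spec_Tsys => //; lia.
rewrite E; apply: spec_sum => B; rewrite mem_asms => aB.
exact: spec_asm_weight.
Qed.
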